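(* Let $\beta\in[0,\beta_c)$. For every $p\ge 1$ there exists a constant $C_1(p)\in(0,\infty)$, depending only on $p$, $\beta$, $d$ and the law of $\mathbf Y$ (and not on $N$ or $M$), such that for all integers $N\ge1$ and $M\in\{1,\dots,N\}$: \[ \big\| D_{KL}(\mu_{\beta,M,N}\,\|\,\mu_{\beta,N})\big\|_p \le C_1(p)\Big\lfloor \frac NM\Big\rfloor, \] and \[ \Big\| D_{KL}(\mu_{\beta,M,N}\,\|\,\mu_{\beta,N}) - \mathbb E\big[D_{KL}(\mu_{\beta,M,N}\,\|\,\mu_{\beta,N})\big]\Big\|_p \le C_1(p). \] Here $\|Z\|_p=\mathbb E[|Z|^p]^{1/p}$.
   Context: Branching random walk: let $d\ge2$ and let $\mathbb T$ be the rooted $d$-ary tree, whose vertices are finite words over $\{0,\dots,d-1\}$; the root is the empty word $\varnothing$, $|v|$ is the length (depth) of $v$, $vw$ denotes concatenation, $v\le w$ means $v$ is a prefix of $w$ and $v<w$ means a strict prefix. $\mathbb T_n$ is the set of vertices of depth $\le n$ and $\partial\mathbb T_n$ the set of vertices of depth exactly $n$. Let $\mathbf Y=(Y_0,\dots,Y_{d-1})$ be a random vector in $\mathbb R^d$ and $(\mathbf Y^v)_{v\in\mathbb T}$ i.i.d. copies of it, written $\mathbf Y^v=(Y_{v0},\dots,Y_{v(d-1)})$; this defines $Y_u$ for every $u\ne\varnothing$. Set $X_\varnothing=0$ and $X_v=\sum_{\varnothing<w\le v}Y_w$. Let $\mathcal F_n=\sigma(X_v:|v|\le n)$ and $X^v_w=X_{vw}-X_v$.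 Let $\varphi(\beta)=\log\mathbb E[\sum_{i=0}^{d-1}e^{\beta Y_i}]\in(-\infty,\infty]$, $\mathcal D(\varphi)=\{\beta:\varphi(\beta)<\infty\}$, with standing assumption that $0$ lies in the interior $\mathcal D(\varphi)^\circ$. Define $\beta_c=\sup\{\beta\in\mathcal D(\varphi)^\circ:\beta\varphi'(\beta)<\varphi(\beta)\}\in(0,\infty]$. Partition functions: $W_{\beta,n}=\sum_{|v|=n}e^{\beta X_v-\varphi(\beta)n}$ and $W^u_{\beta,n}=\sum_{|w|=n}e^{\beta X^u_w-\varphi(\beta)n}$. Gibbs measures: for $|u|=m\le n$, $\mu_{\beta,n}(u)=e^{\beta X_u-\varphi(\beta)m}W^u_{\beta,n-m}/W_{\beta,n}$ and $\mu^v_{\beta,n}(u)=e^{\beta X^v_u-\varphi(\beta)m}W^{vu}_{\beta,n-m}/W^v_{\beta,n}$ (their restrictions to $\partial\mathbb T_m$ are probability measures). Renormalized sampling measure: for $1\le M\le N$, the random probability measure $\mu_{\beta,M,N}$ is defined recursively by $\mu_{\beta,M,0}(\varnothing)=1$ and $\mu_{\beta,M,N\wedge(K+1)M}(vw)=\mu_{\beta,M,KM}(v)\,\mu^v_{\beta,M\wedge(N-KM)}(w)$ for all $|v|=KM$, $|w|=M\wedge(N-KM)$, $0\le K\le\lfloor N/M\rfloor$; it is the law of the output of the algorithm that, starting from $v=\varnothing$, repeatedly picks $w$ with $|w|=M\wedge(N-|v|)$ according to $\mu^v_{\beta,M\wedge(N-|v|)}$ and replaces $v$ by $vw$, until $|v|=N$.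 Kullback–Leibler divergence: $D_{KL}(P\|Q)=\sum_\omega P(\omega)\log(P(\omega)/Q(\omega))$, where for measures on the tree the sum is over $\partial\mathbb T_n$ with $n$ the largest depth at which both measures are defined (probability measures). *)

(* Defs.v *)
From HB Require Import structures.
From mathcomp Require Import all_boot all_order all_algebra.
From mathcomp Require Import all_classical all_reals all_analysis.
Set Implicit Arguments. Unset Strict Implicit. Unset Printing Implicit Defensive.
Import Order.TTheory GRing.Theory Num.Theory.
Import numFieldNormedType.Exports.
Local Open Scope classical_set_scope.
Local Open Scope ring_scope.

(* Vertices of the d-ary tree are words [seq 'I_d]; the root is [::].
   The family of i.i.d. random vectors  Y^v = (Y_{v0},...,Y_{v(d-1)})
   is given as  Yv : seq 'I_d -> 'I_d -> T -> R,  with  Yv v i = Y_{vi}. *)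

Section BRW.
Context {dT : measure_display} {T : measurableType dT} {R : realType}.
Variable (P : probability T R) (d : nat).
Variable Yv : seq 'I_d -> 'I_d -> T -> R.

Definition rect_event (v : seq 'I_d) (B : 'I_d -> set R) : set T :=
  \big[setI/setT]_(i < d) (Yv v i @^-1` B i).

(* (Y^v)_v are mutually independent random vectors, all with the law of Y^[::]
   (laws of random vectors in R^d are determined by measurable rectangles). *)
Definition iid_family : Prop :=
  (forall v i, measurable_fun setT (Yv v i)) /\
  (forall (s : seq (seq 'I_d)) (B : seq 'I_d -> 'I_d -> set R),
      uniq s -> (forall v i, measurable (B v i)) ->
      P (\big[setI/setT]_(v <- s) rect_event v (B v)) =
      (\prod_(v <- s) P (rect_event v (B v)))%E) /\
  (forall (v : seq 'I_d) (B : 'I_d -> set R), (forall i, measurable (B i)) ->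
      P (rect_event v B) = P (rect_event [::] B)).

(* Y = Y^[::] is the generic copy; E[sum_i e^{beta Y_i}] in \bar R *)
Definition mgf (beta : R) : \bar R :=
  (\int[P]_x (\sum_(i < d) expR (beta * Yv [::] i x))%:E)%E.

Definition Dphi : set R := [set beta | (mgf beta < +oo)%E].

Definition Dphi_int : set R :=
  [set beta | exists2 e : R, 0 < e & forall b, `|b - beta| < e -> Dphi b].

(* phi(beta) = log E[sum_i e^{beta Y_i}]  (real-valued, meaningful on D(phi)) *)
Definition phi (beta : R) : R := ln (fine (mgf beta)).

Definition beta_c : \bar R :=
  ereal_sup [set b%:E | b in [set b | Dphi_int b /\ b * derive1 phi b < phi b]].

(* X_v = sum_{[::] < w <= v} Y_w ;  the k-th letter of v is appended to take k v *)
Definition Xv (v : seq 'I_d) (x : T) : R :=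
  \sum_(k < size v) Yv (take k v) (tnth (in_tuple v) k) x.

Definition Xrel (u w : seq 'I_d) (x : T) : R := Xv (u ++ w) x - Xv u x.

Definition Wrel (beta : R) (u : seq 'I_d) (n : nat) (x : T) : R :=
  \sum_(w : n.-tuple 'I_d) expR (beta * Xrel u w x - phi beta * n%:R).

Definition W (beta : R) (n : nat) (x : T) : R :=
  \sum_(w : n.-tuple 'I_d) expR (beta * Xv w x - phi beta * n%:R).

Definition mu_rel (beta : R) (v : seq 'I_d) (n : nat) (u : seq 'I_d) (x : T) : R :=
  expR (beta * Xrel v u x - phi beta * (size u)%:R) *
  Wrel beta (v ++ u) (n - size u) x / Wrel beta v n x.

Definition mu (beta : R) (n : nat) (u : seq 'I_d) (x : T) : R :=
  expR (beta * Xv u x - phi beta * (size u)%:R) *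
  Wrel beta u (n - size u) x / W beta n x.

(* Renormalized sampling measure mu_{beta,M,N}(v), |v| = N: the recursion
   mu_{M,N /\ (K+1)M}(vw) = mu_{M,KM}(v) mu^v_{M /\ (N-KM)}(w), K = 0..floor(N/M),
   unfolded into a product over the blocks of v. *)
Definition muMN (beta : R) (M N : nat) (v : seq 'I_d) (x : T) : R :=
  \prod_(K < (N %/ M).+1)
     mu_rel beta (take (K * M) v) (minn M (N - K * M))
            (take (minn M (N - K * M)) (drop (K * M) v)) x.

Definition DKL (beta : R) (M N : nat) (x : T) : R :=
  \sum_(v : N.-tuple 'I_d)
     muMN beta M N v x * ln (muMN beta M N v x / mu beta N v x).

End BRW.

(* Main.v *)
Require Import Defs.
From HB Require Import structures.
From mathcomp Require Import all_boot all_order all_algebra.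
From mathcomp Require Import all_classical all_reals all_analysis.
From mathcomp Require Import measurable_realfun ring lra.
Import Order.TTheory GRing.Theory Num.Theory.
Import numFieldNormedType.Exports.
Set Implicit Arguments.
Unset Strict Implicit.
Unset Printing Implicit Defensive.
Local Open Scope classical_set_scope.
Local Open Scope ring_scope.

(** Writing [Z_m(v)] for the partition function of the subtree of depth [m] at [v], the ratio of the
    two measures at [v] is [Z_N(root)] divided by the product of the [Z] of the blocks visited by
    [v].  Hence the divergence is [ln Z_N(root)] minus a sum over [K] of averages
    [S_K = sum_{|u| = K M} mu_K(u) ln Z(u)], where the [Z(u)] are i.i.d. and independent of
    the weights [mu_K].  Two estimates suffice.

    (1) [E exp (s |ln Z_m|)] is bounded uniformly in [m] for some [s > 0].  The upper tail is
    [E Z_m = 1].  For the lower tail, [beta < beta_c] gives a bounded moment of order [1 + r], hence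
    [P(Z_m <= 1/4) <= q < 1]; since [Z_{m+1}] is small only if all children are small, the
    exponential moment [x_m] of the negative part satisfies [x_{m+1} <= B (4^s + q x_m)] with
    [B q < 1].

    (2) The Gibbs collision probability has expectation at most [rho < 1], uniformly in the size of
    the block, so that [E sum_u mu_K(u)^2 <= rho^K].  The centred variable [S_K - E S_K] thus
    has variance of order [rho^K]; interpolating with (1), its [L^p] norm decays geometrically
    in [K], and Minkowski's inequality sums the fluctuations to a constant. *)

(** * Random environments on the tree *)

(** The estimates need independence of functionals reading disjoint sets of vertices, and invariance
    under passing to a subtree. Both are proved once, for the law of the environment on its
    canonical space, where [depends_on A] records the vertices that a functional reads; they are
    checked on cylinders and extended by uniqueness of measures on a pi-system. The condition beta <
    beta_c enters through a single b > beta with b phi'(b) < phi(b). For beta > 0, convexity then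
    makes the normalised edge weights a_i satisfy sum_i E a_i^(b/beta) < 1, and interpolating with
    sum_i E a_i = 1 gives an order 1 + r at which the sum is below 1. In the lower tail, every
    generation multiplies the bound by the exponential moment B of the edges crossed. This is
    harmless because B tends to 1 with the exponent s, while q does not depend on s: a small s gives
    B q < 1. The mean of the divergence combines N/M + 2 means of logarithms of partition functions
    (rounding N/M down), each bounded. They alone are responsible for the linear growth of the first
    estimate; the fluctuations contribute a constant to both. *)

Lemma bigsetI_ordE (U : Type) d (F : 'I_d -> set U) :
  \big[setI/setT]_(i < d) F i = [set x | forall i, F i x].
Proof.
rewrite -bigcap_seq; apply/seteqP; split => x /= Fx i; last by move=> _; exact: Fx.
by apply: Fx => /=; exact: mem_index_enum.
Qed.

Section Environment.
Context {R : realType} {d : nat}.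
Local Notation V := (seq 'I_d).

(* [y v i] is the value of [Y_{vi}]. *)
Definition env : Type := V -> 'I_d -> R.

HB.instance Definition _ := gen_eqMixin env.
HB.instance Definition _ := gen_choiceMixin env.
HB.instance Definition _ := isPointed.Build env (fun _ _ => 0).

(** Constraints are grouped by vertex because the [d] coordinates at one vertex may be dependent;
    independence holds only between vertices. *)
Definition cylinder (s : seq V) (B : V -> 'I_d -> set R) : set env :=
  [set y | forall v i, v \in s -> B v i (y v i)].

Definition cylinders (A : pred V) : set (set env) :=
  [set C | exists s B, [/\ uniq s, all A s,
     forall v i, measurable (B v i) & C = cylinder s B]].

(** The underlying type is [env] for every [A]; only the sigma-algebra varies, so one function can
    be tested for measurability with respect to any set of vertices. *)
Definition sigma_env (A : pred V) := g_sigma_algebraType (cylinders A).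

Lemma cylinders_setI (A : pred V) : setI_closed (cylinders A).
Proof.
move=> _ _ [s [B [us As mB ->]]] [s' [B' [us' As' mB' ->]]].
exists (undup (s ++ s')), (fun v i => (if v \in s then B v i else setT) `&`
  (if v \in s' then B' v i else setT)); split.
- exact: undup_uniq.
- apply/allP => v; rewrite mem_undup mem_cat => /orP[] vs.
  + exact: (allP As).
  + exact: (allP As').
- by move=> v i; apply: measurableI; case: ifP.
- apply/seteqP; split => y /=.
    move=> [yB yB'] v i _; split; case: ifP => // vs; [exact: yB|exact: yB'].
  move=> yBB'; split => v i vs; have := yBB' v i;
    rewrite mem_undup mem_cat vs ?orbT => /(_ isT) []; by [].
Qed.

Lemma cylinders_setT (A : pred V) : cylinders A setT.
Proof.
by exists [::], (fun _ _ => setT); split => //; apply/seteqP; split.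
Qed.

Lemma cylinders_sub (A B : pred V) : {subset A <= B} ->
  cylinders A `<=` cylinders B.
Proof.
move=> AB _ [s [D [us As mD ->]]]; exists s, D; split => //.
by apply/allP => v /(allP As); exact: AB.
Qed.

(* Boxed in a [Variant] so that unification does not unfold measurability. *)
Variant depends_on (A : pred V) (F : env -> R) : Prop :=
  DependsOn of measurable_fun setT (F : sigma_env A -> R).

Lemma depends_onE (A : pred V) (F : env -> R) :
  depends_on A F -> measurable_fun setT (F : sigma_env A -> R).
Proof. by case. Qed.

Lemma depends_on_sub (A B : pred V) F : {subset A <= B} ->
  depends_on A F -> depends_on B F.
Proof.
move=> AB [mF]; split=> _ X mX; have := mF measurableT X mX.
by apply: sub_sigma_algebra2; exact: cylinders_sub.
Qed.

Lemma depends_on_coord (A : pred V) v i : A v -> depends_on A (fun y => y v i).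
Proof.
move=> Av; split=> _ X mX; rewrite setTI; apply: sub_sigma_algebra.
exists [:: v], (fun _ j => if j == i then X else setT); split => //=.
- by rewrite Av.
- by move=> _ j; case: ifP.
- apply/seteqP; split => y /=.
    by move=> Xy w j; rewrite inE => /eqP ->; case: eqP => // ->.
  by move=> /(_ v i); rewrite inE !eqxx => /(_ isT).
Qed.

Lemma measurable_env_sub (A B : pred V) : {subset A <= B} ->
  measurable_fun setT (id : sigma_env B -> sigma_env A).
Proof.
move=> AB _ X mX; rewrite setTI; move: X mX.
by apply: sub_sigma_algebra2; exact: cylinders_sub.
Qed.

Lemma measurable_to_env d' (U : measurableType d') (A : pred V) (f : U -> env) :
  (forall v i, A v -> measurable_fun setT (fun x => f x v i)) ->
  measurable_fun setT (f : U -> sigma_env A).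
Proof.
move=> mf; apply: (@measurability _ _ _ (sigma_env A) setT f (cylinders A)) => //.
move=> _ [_ [s [B [us As mB ->]] <-]]; rewrite setTI.
rewrite [X in measurable X](_ : _ =
  \big[setI/setT]_(v <- s) \big[setI/setT]_(i < d) ((fun x => f x v i) @^-1` B v i)).
  elim: s us As => [|v s IH] /=; first by rewrite big_nil.
  move=> /andP[_ us] /andP[Av As]; rewrite big_cons; apply: measurableI; last exact: IH.
  apply: bigsetI_measurable => i _; rewrite -[X in measurable X]setTI; exact: mf.
rewrite -bigcap_seq; apply/seteqP; split => x /= xB v.
  by move=> vs; rewrite bigsetI_ordE => i /=; exact: xB.
by move=> i vs; have := xB v vs; rewrite bigsetI_ordE; apply.
Qed.

Definition shift_env (v : V) (y : env) : env := fun u => y (v ++ u).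

End Environment.

(** * Independence and stationarity of the environment *)

Section LawOfEnvironment.
Context {dT : measure_display} {T : measurableType dT} {R : realType}.
Variables (P : probability T R) (d : nat) (Yv : seq 'I_d -> 'I_d -> T -> R).
Hypothesis iidY : iid_family P Yv.

Definition env_of (x : T) : env := fun v i => Yv v i x.

Lemma measurable_env_of (A : pred (seq 'I_d)) :
  measurable_fun setT (env_of : T -> sigma_env A).
Proof. by apply: measurable_to_env => v i _; have [mY _] := iidY; exact: mY. Qed.

Lemma preimage_cylinder s B : env_of @^-1` cylinder s B =
  \big[setI/setT]_(v <- s) rect_event Yv v (B v).
Proof.
rewrite -bigcap_seq; apply/seteqP; split => x /= xB v.
  by move=> vs; rewrite /rect_event bigsetI_ordE => i /=; exact: xB.
by move=> i vs; have := xB v vs; rewrite /rect_event bigsetI_ordE; apply.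
Qed.

(** Since the supports are disjoint, the two cylinders glue into one over the concatenated list, and
    the product formula of [iid_family] applies to all three. *)
Lemma cylinder_indep (A B : pred (seq 'I_d)) C D :
  (forall v, A v -> B v -> False) -> cylinders A C -> cylinders B D ->
  P (env_of @^-1` (C `&` D)) = (P (env_of @^-1` C) * P (env_of @^-1` D))%E.
Proof.
move=> AB [s [E [us As mE ->]]] [s' [E' [us' Bs' mE' ->]]].
have ss' v : v \in s' -> v \notin s.
  move=> vs'; apply/negP => vs; apply: (AB v); [exact: (allP As)|exact: (allP Bs')].
pose F v := if v \in s then E v else E' v.
have Es : cylinder s E = cylinder s F.
  by apply/seteqP; split => y h v i vs; have := h v i vs; rewrite /F vs.
have Es' : cylinder s' E' = cylinder s' F.
  by apply/seteqP; split => y h v i vs; have := h v i vs; rewrite /F (negbTE (ss' _ vs)).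
have mF v i : measurable (F v i) by rewrite /F; case: ifP.
have -> : cylinder s E `&` cylinder s' E' = cylinder (s ++ s') F.
  rewrite Es Es'; apply/seteqP; split => y /=.
    by move=> [h h'] v i; rewrite mem_cat => /orP[]; [exact: h|exact: h'].
  by move=> h; split => v i vs; apply: h; rewrite mem_cat vs ?orbT.
have [mY [indY _]] := iidY.
rewrite Es Es' !preimage_cylinder !indY// ?big_cat// cat_uniq us us' andbT /=.
by apply/hasPn => v vs'; rewrite ss'.
Qed.

(** Prefixing by [u] is injective, so the shifted event is again a cylinder over distinct vertices;
    its factors at [u ++ v] have the same law as those at [v]. *)
Lemma cylinder_shift (A : pred (seq 'I_d)) u C : cylinders A C ->
  P ((shift_env u \o env_of) @^-1` C) = P (env_of @^-1` C).
Proof.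
move=> [s [B [us As mB ->]]].
pose B' v := B (drop (size u) v).
have B'E v : B' (u ++ v) = B v by rewrite /B' drop_size_cat.
have [mY [indY lawY]] := iidY.
have -> : (shift_env u \o env_of) @^-1` cylinder s B =
    env_of @^-1` cylinder [seq u ++ v | v <- s] B'.
  apply/seteqP; split => x /= h v i.
    by move=> /mapP[w ws ->]; rewrite B'E; exact: h.
  by move=> vs; have := h (u ++ v) i; rewrite B'E; apply; exact: map_f.
have us' : uniq [seq u ++ v | v <- s].
  by rewrite map_inj_uniq// => v w /eqP; rewrite eqseq_cat// eqxx => /eqP.
have mB' v i : measurable (B' v i) by exact: mB.
rewrite !preimage_cylinder !indY// big_map; apply: eq_bigr => v _.
by rewrite B'E (lawY (u ++ v))// (lawY v).
Qed.

Definition env_mfun : {mfun T >-> @sigma_env R d predT} :=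
  HB.pack env_of (isMeasurableFun.Build _ _ _ (@sigma_env R d predT) env_of
    (@measurable_env_of predT)).

End LawOfEnvironment.

(** Stated on cylinders only, where both properties can be read off [iid_family]; the cylinders form
    a pi-system, which is enough to recover them for all measurable events. *)
Definition iid_law {R : realType} {d} (Q : probability (@sigma_env R d predT) R) :=
  (forall (A B : pred (seq 'I_d)) C D, (forall v, A v -> B v -> False) ->
     cylinders A C -> cylinders B D -> Q (C `&` D) = (Q C * Q D)%E) /\
  (forall (A : pred (seq 'I_d)) u C, cylinders A C -> Q (shift_env u @^-1` C) = Q C).

Section Expectation.
Context {R : realType} {d : nat}.
Variable Q : probability (@sigma_env R d predT) R.
Hypothesis iidQ : iid_law Q.
Local Notation V := (seq 'I_d).
Implicit Types (A B : pred V) (F G : @env R d -> R).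

Lemma sigma_env_sub A : <<s @cylinders R d A >> `<=`
  @measurable _ (@sigma_env R d predT).
Proof. by apply: sub_sigma_algebra2; exact: cylinders_sub. Qed.

(** For fixed [D] both sides are finite measures in [C] that agree on a generating pi-system. *)
Let indep_step A D : measurable (D : set (sigma_env predT)) ->
  (forall C, cylinders A C -> Q (C `&` D) = (Q C * Q D)%E) ->
  forall C, <<s cylinders A >> C -> Q (C `&` D) = (Q C * Q D)%E.
Proof.
move=> mD AD C sC.
have QD0 : 0 <= fine (Q D) by apply: fine_ge0; exact: measure_ge0.
have QDE : (fine (Q D))%:E = Q D by rewrite fineK// fin_num_measure.
have scaleE E : mscale (NngNum QD0) Q E = (Q E * Q D)%E.
  by rewrite /mscale /= QDE muleC.
rewrite -scaleE -[LHS]/(mrestr Q mD C).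
apply: (@g_sigma_algebra_measure_unique _ R (@sigma_env R d predT) (cylinders A)
  _ (fun=> setT)) sC => //.
- by apply: subset_trans (@sigma_env_sub A); exact: sub_sigma_algebra.
- by move=> _; exact: cylinders_setT.
- by apply/seteqP; split => // x _; exists 0%N.
- exact: cylinders_setI.
- by move=> E EA; rewrite [RHS]scaleE -AD.
- by move=> _; rewrite /= /mrestr setTI -ge0_fin_numE ?fin_num_measure.
Qed.

(** The extension from cylinders to sigma-algebras is made one argument at a time. *)
Lemma sigma_indep A B C D : (forall v, A v -> B v -> False) ->
  <<s cylinders A >> C -> <<s cylinders B >> D -> Q (C `&` D) = (Q C * Q D)%E.
Proof.
move=> AB sC sD; apply: (@indep_step A) => //; first exact: sigma_env_sub sD.
move=> {sC}C cC; rewrite setIC muleC; apply: (@indep_step B) => //.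
  by apply: (@sigma_env_sub A); exact: sub_sigma_algebra.
move=> {sD}D cD; rewrite setIC muleC; have [indQ _] := iidQ; exact: (indQ A B).
Qed.

Lemma depends_on_meas A F : depends_on A F -> depends_on predT F.
Proof. exact: depends_on_sub. Qed.

Definition to_sigma A : @sigma_env R d predT -> @sigma_env R d A := id.
HB.instance Definition _ A := isMeasurableFun.Build _ _ _ _ (to_sigma A)
  (@measurable_env_sub R d A predT (fun _ _ => isT)).

Definition diag_env A B (y : @sigma_env R d predT) :
  (@sigma_env R d A * @sigma_env R d B)%type := (to_sigma A y, to_sigma B y).

Let measurable_diag_env A B : measurable_fun setT (diag_env A B).
Proof. by apply: measurable_fun_pair; exact: measurable_funPT. Qed.
HB.instance Definition _ A B := isMeasurableFun.Build _ _ _ _ (diag_env A B)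
  (@measurable_diag_env A B).

Local Open Scope ereal_scope.

(** By uniqueness of product measures, the law of the diagonal map is the product of its two
    marginals; Tonelli then factors the integral. *)
Lemma ge0_expectation_indep A B F G : (forall v, A v -> B v -> False) ->
  depends_on A F -> depends_on B G -> (forall y, 0 <= F y)%R -> (forall y, 0 <= G y)%R ->
  \int[Q]_y (F y * G y)%:E = \int[Q]_y (F y)%:E * \int[Q]_y (G y)%:E.
Proof.
move=> AB [mF] [mG] F0 G0.
pose H (z : @sigma_env R d A * @sigma_env R d B) := (F z.1)%:E * (G z.2)%:E.
have mF' : measurable_fun setT (fun y : sigma_env A => (F y)%:E) by exact/measurable_EFinP.
have mG' : measurable_fun setT (fun y : sigma_env B => (G y)%:E) by exact/measurable_EFinP.
have mH : measurable_fun setT H.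
  by apply: emeasurable_funM;
    [exact: (measurableT_comp mF' measurable_fst)|exact: (measurableT_comp mG' measurable_snd)].
have H0 z : 0 <= H z by rewrite mule_ge0// lee_fin.
transitivity (\int[distribution Q (diag_env A B)]_z H z).
  by rewrite ge0_integral_distribution.
transitivity (\int[distribution Q (to_sigma A) \x distribution Q (to_sigma B)]_z H z).
  apply: eq_measure_integral => X mX _; apply/esym/product_measure_unique => //.
  by move=> C D mC mD; exact: (sigma_indep AB).
rewrite fubini_tonelli1//.
have FE : \int[Q]_y (F y)%:E = \int[distribution Q (to_sigma A)]_y (F y)%:E.
  by rewrite ge0_integral_distribution// => y; rewrite lee_fin.
have GE : \int[Q]_y (G y)%:E = \int[distribution Q (to_sigma B)]_y (G y)%:E.
  by rewrite ge0_integral_distribution// => y; rewrite lee_fin.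
rewrite GE FE -ge0_integralZr//; last 2 first.
- by move=> y _; rewrite lee_fin.
- by apply: integral_ge0 => y _; rewrite lee_fin.
apply: eq_integral => y _; rewrite /fubini_F /H/= ge0_integralZl//.
- by move=> x _; rewrite lee_fin.
- by rewrite lee_fin.
Qed.

End Expectation.

(** * Expectations and independence *)

Section DependsOn.
Context {R : realType} {d : nat}.
Implicit Types (A : pred (seq 'I_d)) (F G : @env R d -> R).

Lemma depends_on_cst A (c : R) : depends_on A (fun _ : @env R d => c).
Proof. by split; exact: measurable_cst. Qed.

Lemma depends_on_comp A (g : R -> R) F : measurable_fun setT g ->
  depends_on A F -> depends_on A (fun y => g (F y)).
Proof. by move=> mg [mF]; split; exact: (measurableT_comp mg mF). Qed.

Lemma depends_onD A F G : depends_on A F -> depends_on A G ->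
  depends_on A (fun y => F y + G y).
Proof. by move=> [mF] [mG]; split; exact: measurable_funD. Qed.

Lemma depends_onB A F G : depends_on A F -> depends_on A G ->
  depends_on A (fun y => F y - G y).
Proof. by move=> [mF] [mG]; split; exact: measurable_funB. Qed.

Lemma depends_onM A F G : depends_on A F -> depends_on A G ->
  depends_on A (fun y => F y * G y).
Proof. by move=> [mF] [mG]; split; exact: measurable_funM. Qed.

Lemma depends_on_sum A (I : Type) (s : seq I) (F : I -> @env R d -> R) :
  (forall i, depends_on A (F i)) -> depends_on A (fun y => \sum_(i <- s) F i y).
Proof. by move=> mF; split; apply: measurable_sum => i; exact: depends_onE. Qed.

Lemma depends_on_prod A (I : Type) (s : seq I) (F : I -> @env R d -> R) :
  (forall i, depends_on A (F i)) -> depends_on A (fun y => \prod_(i <- s) F i y).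
Proof.
move=> mF; elim: s => [|i s IH].
  rewrite (_ : (fun y => _) = fun=> 1); first exact: depends_on_cst.
  by apply/funext => y; rewrite big_nil.
rewrite (_ : (fun y => _) = fun y => F i y * \prod_(j <- s) F j y).
  exact: depends_onM.
by apply/funext => y; rewrite big_cons.
Qed.

Lemma depends_on_expR A F : depends_on A F -> depends_on A (fun y => expR (F y)).
Proof. by apply: depends_on_comp; exact: measurable_expR. Qed.

Lemma depends_on_ln A F : depends_on A F -> depends_on A (fun y => ln (F y)).
Proof. by apply: depends_on_comp; exact: measurable_ln. Qed.

Lemma depends_on_inv A F : (forall y, 0 < F y) ->
  depends_on A F -> depends_on A (fun y => (F y)^-1).
Proof.
move=> F0 mF; rewrite (_ : (fun y => _) = fun y => expR (- ln (F y))).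
  by apply: depends_on_expR; apply: (@depends_on_comp _ -%R) => //; exact: depends_on_ln.
by apply/funext => y; rewrite expRN lnK// posrE.
Qed.

Lemma depends_on_normr A F : depends_on A F -> depends_on A (fun y => `|F y|).
Proof. by apply: depends_on_comp; exact: normr_measurable. Qed.

Lemma depends_on_powR A F p : depends_on A F -> depends_on A (fun y => F y `^ p).
Proof. by apply: (@depends_on_comp _ (fun x => x `^ p)); exact: measurable_powR. Qed.

Lemma depends_on_max A F c : depends_on A F -> depends_on A (fun y => Num.max (F y) c).
Proof. by move=> [mF]; split; apply: measurable_maxr => //; exact: measurable_cst. Qed.

Lemma depends_on_le A F c : depends_on A F ->
  depends_on A (fun y => (F y <= c)%R%:R).
Proof.
apply: (@depends_on_comp _ (fun x => (x <= c)%R%:R)).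
rewrite (_ : (fun x => _) = \1_(`]-oo, c])); first exact: measurable_indic.
by apply/funext => x; rewrite indicE mem_setE in_itv/=.
Qed.

End DependsOn.

Section ExpectationCalculus.
Context {R : realType} {d : nat}.
Variable Q : probability (@sigma_env R d predT) R.
Local Notation V := (seq 'I_d).
Implicit Types (A B : pred V) (F G : @env R d -> R) (b c : R).

Definition L1 F := Q.-integrable setT (EFin \o F).
Definition EQ F : R := fine (\int[Q]_y (F y)%:E).
(** Integrability is bundled with the bound because [fine] sends an infinite integral to 0, so that
    [EQ F <= c] alone would not exclude it. *)
Definition EQ_le F c := L1 F /\ EQ F <= c.

Lemma L1_meas F : L1 F -> depends_on predT F.
Proof. by move=> /integrableP[/measurable_EFinP mF _]; split. Qed.

Lemma integral_EQ F : L1 F -> (\int[Q]_y (F y)%:E)%E = (EQ F)%:E.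
Proof. by move=> iF; rewrite /EQ fineK//; exact: integrable_fin_num. Qed.

Lemma L1_le F G : depends_on predT F -> (forall y, `|F y| <= G y) -> L1 G -> L1 F.
Proof.
move=> [mF] FG iG; apply: (le_integrable measurableT _ _ iG); first exact/measurable_EFinP.
by move=> y _; rewrite /= lee_fin (le_trans (FG y))// ler_norm.
Qed.

Lemma L1_cst c : L1 (fun=> c).
Proof. exact: finite_measure_integrable_cst. Qed.

Lemma EQ_cst c : EQ (fun=> c) = c.
Proof.
rewrite /EQ integral_cst//= [X in (_ * X)%E](_ : _ = 1%E) ?mule1//.
exact: probability_setT.
Qed.

Lemma L1D F G : L1 F -> L1 G -> L1 (fun y => F y + G y).
Proof. by move=> iF iG; exact: (integrableD measurableT iF iG). Qed.

Lemma EQD F G : L1 F -> L1 G -> EQ (fun y => F y + G y) = EQ F + EQ G.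
Proof.
by move=> iF iG; rewrite /EQ integralD_EFin// fineD//; exact: integrable_fin_num.
Qed.

Lemma L1Z c F : L1 F -> L1 (fun y => c * F y).
Proof. by move=> iF; exact: (integrableZl measurableT c iF). Qed.

Lemma EQZ c F : L1 F -> EQ (fun y => c * F y) = c * EQ F.
Proof. by move=> iF; exact: (RintegralZl _ _ iF). Qed.

Lemma L1B F G : L1 F -> L1 G -> L1 (fun y => F y - G y).
Proof. by move=> iF iG; exact: (integrableB measurableT iF iG). Qed.

Lemma EQB F G : L1 F -> L1 G -> EQ (fun y => F y - G y) = EQ F - EQ G.
Proof. by move=> iF iG; exact: (RintegralB _ iF iG). Qed.

Lemma L1_sum (I : Type) (s : seq I) (F : I -> @env R d -> R) :
  (forall i, L1 (F i)) -> L1 (fun y => \sum_(i <- s) F i y).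
Proof.
move=> iF; elim: s => [|i s IH].
  by rewrite (_ : (fun y => _) = fun=> 0); [exact: L1_cst|apply/funext => y; rewrite big_nil].
rewrite (_ : (fun y => _) = fun y => F i y + \sum_(j <- s) F j y); first exact: L1D.
by apply/funext => y; rewrite big_cons.
Qed.

Lemma EQ_sum (I : Type) (s : seq I) (F : I -> @env R d -> R) :
  (forall i, L1 (F i)) -> EQ (fun y => \sum_(i <- s) F i y) = \sum_(i <- s) EQ (F i).
Proof.
move=> iF; elim: s => [|i s IH].
  rewrite (_ : (fun y => _) = fun=> 0) ?EQ_cst ?big_nil//.
  by apply/funext => y; rewrite big_nil.
rewrite (_ : (fun y => _) = fun y => F i y + \sum_(j <- s) F j y); last first.
  by apply/funext => y; rewrite big_cons.
by rewrite EQD ?big_cons ?IH//; exact: L1_sum.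
Qed.

Lemma EQ_mono F G : L1 F -> L1 G -> (forall y, F y <= G y) -> EQ F <= EQ G.
Proof. by move=> iF iG FG; apply: le_Rintegral => // y _; exact: FG. Qed.

Lemma EQ_ge0 F : (forall y, 0 <= F y) -> 0 <= EQ F.
Proof. by move=> F0; apply: Rintegral_ge0. Qed.

Lemma le_normr_EQ F : L1 F -> `|EQ F| <= EQ (fun y => `|F y|).
Proof. by move=> iF; exact: (le_normr_Rintegral _ iF). Qed.

Lemma EQ_le_cst c : EQ_le (fun=> c) c.
Proof. by split; [exact: L1_cst|rewrite EQ_cst]. Qed.

Lemma EQ_leD F G b c : EQ_le F b -> EQ_le G c -> EQ_le (fun y => F y + G y) (b + c).
Proof. by move=> [iF Fb] [iG Gc]; split; [exact: L1D|rewrite EQD// lerD]. Qed.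

Lemma EQ_leZ k F c : 0 <= k -> EQ_le F c -> EQ_le (fun y => k * F y) (k * c).
Proof. by move=> k0 [iF Fc]; split; [exact: L1Z|rewrite EQZ// ler_wpM2l]. Qed.

Lemma EQ_le_sum (I : Type) (s : seq I) (F : I -> @env R d -> R) (c : I -> R) :
  (forall i, EQ_le (F i) (c i)) ->
  EQ_le (fun y => \sum_(i <- s) F i y) (\sum_(i <- s) c i).
Proof.
move=> Fc; have iF i : L1 (F i) by case: (Fc i).
by split; [exact: L1_sum|rewrite EQ_sum// ler_sum// => i _; case: (Fc i)].
Qed.

Lemma EQ_le_mono F G c : depends_on predT F -> (forall y, 0 <= F y <= G y) ->
  EQ_le G c -> EQ_le F c.
Proof.
move=> mF FG [iG Gc].
have iF : L1 F.
  by apply: L1_le iG => // y; have /andP[F0 ?] := FG y; rewrite ger0_norm.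
split => //; apply: le_trans Gc; apply: EQ_mono => // y.
by have /andP[] := FG y.
Qed.

Lemma EQ_le_trans F b c : EQ_le F b -> b <= c -> EQ_le F c.
Proof. by move=> [iF Fb] bc; split => //; exact: le_trans bc. Qed.

Lemma EQ_le_lty F : depends_on predT F -> (forall y, 0 <= F y) ->
  (\int[Q]_y (F y)%:E < +oo)%E -> L1 F.
Proof.
move=> [mF] F0 Foo; apply/integrableP; split; first exact/measurable_EFinP.
by under eq_integral do rewrite /= ger0_norm//.
Qed.

Hypothesis iidQ : iid_law Q.

Lemma EQ_indep_ge0 A B F G : (forall v, A v -> B v -> False) ->
  depends_on A F -> depends_on B G -> (forall y, 0 <= F y) -> (forall y, 0 <= G y) ->
  L1 F -> L1 G -> L1 (fun y => F y * G y) /\ EQ (fun y => F y * G y) = EQ F * EQ G.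
Proof.
move=> AB mF mG F0 G0 iF iG.
have FGE := ge0_expectation_indep iidQ AB mF mG F0 G0.
split; last by rewrite /EQ FGE (integral_EQ iF) (integral_EQ iG).
apply: EQ_le_lty; first by apply: depends_onM; exact: L1_meas.
  by move=> y; exact: mulr_ge0.
by rewrite FGE (integral_EQ iF) (integral_EQ iG) -EFinM ltry.
Qed.

Lemma EQ_leM A B F G b c : (forall v, A v -> B v -> False) ->
  depends_on A F -> depends_on B G -> (forall y, 0 <= F y) -> (forall y, 0 <= G y) ->
  EQ_le F b -> EQ_le G c -> EQ_le (fun y => F y * G y) (b * c).
Proof.
move=> AB mF mG F0 G0 [iF Fb] [iG Gc].
have [iFG EFG] := EQ_indep_ge0 AB mF mG F0 G0 iF iG.
by split => //; rewrite EFG ler_pM// ?EQ_ge0.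
Qed.

(** The nonnegative case is applied to the four products of positive and negative parts. *)
Lemma EQ_indep A B F G : (forall v, A v -> B v -> False) ->
  depends_on A F -> depends_on B G -> L1 F -> L1 G ->
  L1 (fun y => F y * G y) /\ EQ (fun y => F y * G y) = EQ F * EQ G.
Proof.
move=> AB mF mG iF iG.
pose pos (H : @env R d -> R) y := Num.max (H y) 0.
pose neg (H : @env R d -> R) y := Num.max (-1 * H y) 0.
have posE H y : H y = pos H y - neg H y.
  by rewrite /pos /neg !maxEle; case: ifP => ?; case: ifP => ?; lra.
have posN H y : `|pos H y| <= `|H y|.
  by rewrite /pos !maxEle; case: ifP => ?; rewrite ?normr0.
have negN H y : `|neg H y| <= `|H y|.
  by rewrite /neg !maxEle; case: ifP => ?; rewrite ?normr0// mulN1r normrN.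
have pos0 H y : 0 <= pos H y by rewrite /pos le_max lexx orbT.
have neg0 H y : 0 <= neg H y by rewrite /neg le_max lexx orbT.
have mpos C H : depends_on C H -> depends_on C (pos H) by exact: depends_on_max.
have mneg C H : depends_on C H -> depends_on C (neg H).
  move=> mH; apply: depends_on_max; apply: depends_onM => //; exact: depends_on_cst.
have iN H : L1 H -> L1 (fun y => `|H y|).
  move=> iH; exact: (integrable_norm iH).
have ipos H : L1 H -> L1 (pos H).
  by move=> iH; apply: (L1_le _ _ (iN _ iH)) => //; exact: (mpos _ _ (L1_meas iH)).
have ineg H : L1 H -> L1 (neg H).
  by move=> iH; apply: (L1_le _ _ (iN _ iH)) => //; exact: (mneg _ _ (L1_meas iH)).
have [i1 E1] := EQ_indep_ge0 AB (mpos _ _ mF) (mpos _ _ mG)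
  (pos0 F) (pos0 G) (ipos _ iF) (ipos _ iG).
have [i2 E2] := EQ_indep_ge0 AB (mpos _ _ mF) (mneg _ _ mG)
  (pos0 F) (neg0 G) (ipos _ iF) (ineg _ iG).
have [i3 E3] := EQ_indep_ge0 AB (mneg _ _ mF) (mpos _ _ mG)
  (neg0 F) (pos0 G) (ineg _ iF) (ipos _ iG).
have [i4 E4] := EQ_indep_ge0 AB (mneg _ _ mF) (mneg _ _ mG)
  (neg0 F) (neg0 G) (ineg _ iF) (ineg _ iG).
have FGE : (fun y => F y * G y) = fun y => pos F y * pos G y - pos F y * neg G y
    - (neg F y * pos G y - neg F y * neg G y).
  by apply/funext => y; rewrite (posE F) (posE G); ring.
have EE H : L1 H -> EQ H = EQ (pos H) - EQ (neg H).
  move=> iH; rewrite -EQB; [|exact: ipos|exact: ineg].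
  by congr EQ; apply/funext => y; exact: posE.
rewrite FGE; split; first by apply: L1B; exact: L1B.
rewrite !EQB//; try exact: L1B.
by rewrite E1 E2 E3 E4 (EE _ iF) (EE _ iG); ring.
Qed.

Lemma measurable_shift_env u : measurable_fun setT
  (shift_env u : @sigma_env R d predT -> @sigma_env R d predT).
Proof. by apply: measurable_to_env => v i _; apply: depends_onE; exact: depends_on_coord. Qed.

Definition shift_mfun u : {mfun (@sigma_env R d predT) >-> (@sigma_env R d predT)} :=
  HB.pack (shift_env u : @sigma_env R d predT -> @sigma_env R d predT)
    (isMeasurableFun.Build _ _ (@sigma_env R d predT) (@sigma_env R d predT)
       _ (@measurable_shift_env u)).

Lemma iid_law_shift u (C : set (@sigma_env R d predT)) :
  measurable C -> Q C = distribution Q (shift_mfun u) C.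
Proof.
move=> mC.
apply: (@measure_unique _ R (@sigma_env R d predT) (cylinders predT) (fun=> setT)) => //.
- exact: cylinders_setI.
- by move=> _; exact: cylinders_setT.
- by apply/seteqP; split => // x _; exists 0%N.
- by move=> D cD; have [_ shQ] := iidQ; apply/esym; exact: (shQ _ u _ cD).
- by move=> _; rewrite /= -ge0_fin_numE ?fin_num_measure.
Qed.

Lemma EQ_shift u F : L1 F -> L1 (F \o shift_env u) /\ EQ (F \o shift_env u) = EQ F.
Proof.
move=> iF; have mF := depends_onE (L1_meas iF); have msh := @measurable_shift_env u.
have shE (f : @sigma_env R d predT -> \bar R) :
    (\int[Q]_y f y = \int[distribution Q (shift_mfun u)]_y f y)%E.
  by apply: eq_measure_integral => C mC _; exact: iid_law_shift.
have mF' : measurable_fun setT (fun y : sigma_env predT => (F y)%:E).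
  exact/measurable_EFinP.
have iFs : L1 (F \o shift_env u).
  have mFs := measurableT_comp mF msh.
  apply/integrableP; split; first exact/measurable_EFinP.
  have /integrableP[_] := iF; rewrite shE ge0_integral_distribution//.
  by apply: (measurableT_comp _ mF'); exact: abse_measurable.
by split => //; rewrite /EQ [in RHS]shE integral_distribution.
Qed.

End ExpectationCalculus.

(** * Partition functions and Gibbs measures *)

Section WordSums.
Context {R : realType} {d : nat}.
Implicit Types (F G : seq 'I_d -> R).

Definition word_sum n F : R := \sum_(w : n.-tuple 'I_d) F w.

Lemma eq_word_sum n F G : (forall w, size w = n -> F w = G w) ->
  word_sum n F = word_sum n G.
Proof. by move=> FG; apply: eq_bigr => w _; rewrite FG// size_tuple. Qed.

Lemma word_sum0 F : word_sum 0 F = F [::].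
Proof.
rewrite /word_sum (big_pred1 [tuple]) //= => w; rewrite [w]tuple0.
by apply/esym/eqP.
Qed.

Lemma word_sumS n F : word_sum n.+1 F = \sum_(i < d) word_sum n (fun w => F (i :: w)).
Proof.
rewrite /word_sum pair_big /=.
rewrite (reindex (fun p : 'I_d * n.-tuple 'I_d => cons_tuple p.1 p.2)) //=.
exists (fun w : n.+1.-tuple 'I_d => (thead w, behead_tuple w)) => /=.
- by move=> [i w] _ /=; congr pair; apply: val_inj.
- by move=> w _; apply: val_inj => /=; rewrite [in RHS](tuple_eta w).
Qed.

Lemma word_sum_cat m n F :
  word_sum (m + n) F = word_sum m (fun u => word_sum n (fun w => F (u ++ w))).
Proof.
elim: m F => [|m IH] F; first by rewrite add0n word_sum0.
by rewrite addSn !word_sumS; apply: eq_bigr => i _; rewrite IH.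
Qed.

Lemma word_sumZ n c F : word_sum n (fun w => c * F w) = c * word_sum n F.
Proof. by rewrite /word_sum mulr_sumr. Qed.

Lemma word_sum_ge0 n F : (forall w, 0 <= F w) -> 0 <= word_sum n F.
Proof. by move=> F0; apply: sumr_ge0. Qed.

Lemma ler_word_sum n F G : (forall w, size w = n -> F w <= G w) ->
  word_sum n F <= word_sum n G.
Proof. by move=> FG; apply: ler_sum => w _; rewrite FG// size_tuple. Qed.

Lemma word_le_sum n F w : (forall w, 0 <= F w) -> size w = n -> F w <= word_sum n F.
Proof.
move=> F0 /eqP wn; rewrite /word_sum (bigD1 (Tuple wn))//= lerDl.
exact: sumr_ge0.
Qed.

End WordSums.

Section PartitionFunction.
Context {R : realType} {d : nat}.
Variables (b f : R).
Local Notation V := (seq 'I_d).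
Local Notation env := (@env R d).
Implicit Types (v w u : V) (y : env).

Definition edge_weight v i y : R := expR (b * y v i - f).

Fixpoint path_weight w v y : R :=
  if w is i :: w' then edge_weight v i y * path_weight w' (rcons v i) y else 1.

(** This is $W^v_n$, unfolded at the first generation: the edges at [v] and the partition functions
    of its children are then independent. *)
Fixpoint part_fun n v y : R :=
  if n is n'.+1 then \sum_(i < d) edge_weight v i y * part_fun n' (rcons v i) y else 1.

Lemma part_funE n v y : part_fun n v y = word_sum n (fun w => path_weight w v y).
Proof.
elim: n v => [|n IH] v; first by rewrite word_sum0.
by rewrite word_sumS /=; apply: eq_bigr => i _; rewrite IH word_sumZ.
Qed.

Lemma path_weight_cat u w v y :
  path_weight (u ++ w) v y = path_weight u v y * path_weight w (v ++ u) y.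
Proof.
elim: u v => [|i u IH] v /=; first by rewrite mul1r cats0.
by rewrite IH mulrA cat_rcons.
Qed.

Lemma edge_weight_gt0 v i y : 0 < edge_weight v i y.
Proof. exact: expR_gt0. Qed.

Lemma path_weight_gt0 w v y : 0 < path_weight w v y.
Proof. by elim: w v => //= i w IH v; rewrite mulr_gt0// edge_weight_gt0. Qed.

Lemma part_fun_ge0 n v y : 0 <= part_fun n v y.
Proof.
elim: n v => //= n IH v; apply: sumr_ge0 => i _.
by rewrite mulr_ge0// ltW// edge_weight_gt0.
Qed.

Hypothesis d_gt0 : (0 < d)%N.

Lemma part_fun_gt0 n v y : 0 < part_fun n v y.
Proof.
elim: n v => //= n IH v; rewrite (bigD1 (Ordinal d_gt0))//=.
rewrite ltr_pwDl ?mulr_gt0 ?edge_weight_gt0//.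
by apply: sumr_ge0 => i _; rewrite mulr_ge0// ltW// edge_weight_gt0.
Qed.

Lemma part_fun_shift n u v y : part_fun n (u ++ v) y = part_fun n v (shift_env u y).
Proof.
elim: n v => //= n IH v; apply: eq_bigr => i _.
by rewrite rcons_cat IH.
Qed.

(** The vertices whose vectors determine [part_fun n v]. The size bound is strict because the last
    edges, leading to depth [size v + n], are stored at their upper endpoints. *)
Definition subtree v n : pred V := [pred u | prefix v u && (size u < size v + n)%N].

Lemma subtree_rcons v i n u : subtree (rcons v i) n u -> subtree v n.+1 u.
Proof.
rewrite /subtree /= size_rcons addSnnS => /andP[p ->]; rewrite andbT.
by apply: prefix_trans p; exact: prefix_rcons.
Qed.

Lemma subtree_root v n : subtree v n.+1 v.
Proof. by rewrite /subtree /= prefix_refl -addSnnS leq_addr. Qed.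

Lemma subtree_prefix v n u : subtree v n u -> prefix v u.
Proof. by move=> /andP[]. Qed.

Lemma subtree_size v n u : subtree v n u -> (size u < size v + n)%N.
Proof. by move=> /andP[]. Qed.

Lemma depends_on_edge_weight (A : pred V) v i : A v -> depends_on A (edge_weight v i).
Proof.
move=> Av; apply: depends_on_expR; apply: depends_onB; last exact: depends_on_cst.
by apply: depends_onM; [exact: depends_on_cst|exact: depends_on_coord].
Qed.

Lemma depends_on_part_fun n v : depends_on (subtree v n) (part_fun n v).
Proof.
elim: n v => [|n IH] v; first exact: depends_on_cst.
apply: depends_on_sum => i; apply: depends_onM.
  by apply: depends_on_edge_weight; exact: subtree_root.
by apply: depends_on_sub (IH _) => u; exact: subtree_rcons.
Qed.

Lemma depends_on_path_weight w v :
  depends_on (subtree v (size w)) (path_weight w v).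
Proof.
elim: w v => [|i w IH] v; first exact: depends_on_cst.
apply: depends_onM.
  by apply: depends_on_edge_weight; exact: subtree_root.
by apply: depends_on_sub (IH _) => u; exact: subtree_rcons.
Qed.

Lemma depends_on_ln_part_fun n v :
  depends_on (subtree v n) (fun y => ln (part_fun n v y)).
Proof. by apply: depends_on_ln; exact: depends_on_part_fun. Qed.

Definition gibbs n v w y : R := path_weight w v y / part_fun n v y.

Lemma depends_on_gibbs n v w : size w = n -> depends_on (subtree v n) (gibbs n v w).
Proof.
move=> wn; apply: depends_onM; first by rewrite -wn; exact: depends_on_path_weight.
by apply: depends_on_inv; [move=> y; exact: part_fun_gt0|exact: depends_on_part_fun].
Qed.

Lemma gibbs_ge0 n v w y : 0 <= gibbs n v w y.
Proof. by rewrite divr_ge0 ?part_fun_ge0// ltW// path_weight_gt0. Qed.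

Lemma sum_gibbs n v y : word_sum n (fun w => gibbs n v w y) = 1.
Proof.
transitivity (part_fun n v y / part_fun n v y); last first.
  by rewrite divff// gt_eqF// part_fun_gt0.
by rewrite [in X in X / _]part_funE /gibbs /word_sum mulr_suml.
Qed.

(* The law of the first [k] blocks sampled by the algorithm, block [K] having length [m K];
   all lengths are [M], except for that of the last block when [M] does not divide [N]. *)
Definition renorm (m : nat -> nat) M k v y : R :=
  \prod_(K < k) gibbs (m K) (take (K * M) v) (take (m K) (drop (K * M) v)) y.

Lemma renorm_ge0 m M k v y : 0 <= renorm m M k v y.
Proof. by apply: prodr_ge0 => K _; exact: gibbs_ge0. Qed.

Lemma eq_renorm m m' M k v y : (forall K, (K < k)%N -> m K = m' K) ->
  renorm m M k v y = renorm m' M k v y.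
Proof. by move=> mm'; apply: eq_bigr => K _; rewrite mm'. Qed.

Lemma renorm_cat m M k u w y : size u = (k * M)%N -> size w = m k ->
  (forall K, (K < k)%N -> (m K <= M)%N) ->
  renorm m M k.+1 (u ++ w) y = renorm m M k u y * gibbs (m k) u w y.
Proof.
move=> su sw mM; rewrite /renorm big_ord_recr /=; congr (_ * _); last first.
  by rewrite take_size_cat// drop_size_cat// -sw take_size.
apply: eq_bigr => -[K Kk] _ /=; have KM : (K.+1 * M <= size u)%N by rewrite su leq_mul2r Kk orbT.
have KMu : (K * M <= size u)%N by apply: leq_trans KM; rewrite leq_mul2r leqnSn orbT.
rewrite takel_cat// drop_cat; case: ltnP => uKM.
  rewrite takel_cat// size_drop; apply: leq_trans (mM _ Kk) _.
  by rewrite leq_subRL// -mulSnr.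
(* Here [K.+1 * M <= size u <= K * M], which forces [M = 0], so that all blocks are empty. *)
have uE : size u = (K * M)%N by apply/eqP; rewrite eqn_leq uKM KMu.
have M0 : M = 0%N.
  by apply/eqP; move: KM; rewrite uE mulSn -{2}[(K * M)%N]add0n leq_add2r leqn0.
have -> : m K = 0%N by apply/eqP; have := mM _ Kk; rewrite M0 leqn0.
by rewrite !take0.
Qed.

Lemma sum_renormS m M k (g : V -> R) y :
  (forall K, (K < k)%N -> (m K <= M)%N) ->
  word_sum (k * M + m k) (fun v => renorm m M k.+1 v y * g (take (k * M) v)) =
  word_sum (k * M) (fun u => renorm m M k u y * g u).
Proof.
move=> mM; rewrite word_sum_cat; apply: eq_word_sum => u su.
transitivity (word_sum (m k) (fun w => renorm m M k u y * g u * gibbs (m k) u w y)).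
  by apply: eq_word_sum => w sw; rewrite renorm_cat// take_size_cat// mulrAC.
by rewrite word_sumZ sum_gibbs mulr1.
Qed.

Section Blocks.
Variables (M N : nat).
Hypothesis M_gt0 : (0 < M)%N.
Let m K := minn M (N - K * M).

Lemma block_len K : (K < N %/ M)%N -> m K = M.
Proof.
move=> KN; rewrite /m; apply/minn_idPl; rewrite leq_subRL.
  by rewrite -mulSnr -leq_divRL.
by rewrite -leq_divRL// ltnW.
Qed.

Lemma block_len_le K : (m K <= M)%N.
Proof. exact: geq_minl. Qed.

Lemma block_end k : (k <= N %/ M)%N -> minn (k.+1 * M) N = (k * M + m k)%N.
Proof.
rewrite leq_divRL// => kN.
by rewrite /m addn_minr subnKC// -mulSnr.
Qed.

(** The blocks after the first [k] are summed out from the end, Gibbs weights having total mass 1;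
    the first [k <= N %/ M] blocks all have full length [M]. *)
Lemma sum_renorm_marginal k (g : V -> R) y : (k <= N %/ M)%N ->
  word_sum N (fun v => renorm m M (N %/ M).+1 v y * g (take (k * M) v)) =
  word_sum (k * M) (fun u => renorm (fun=> M) M k u y * g u).
Proof.
move=> kN.
(* [minn (j * M) N] is the depth reached after [j] blocks, also when the last one is short or
   empty. *)
suff H j : (k <= j)%N -> (j <= (N %/ M).+1)%N ->
    word_sum (minn (j * M) N) (fun v => renorm m M j v y * g (take (k * M) v)) =
    word_sum (k * M) (fun u => renorm (fun=> M) M k u y * g u).
  have := H (N %/ M).+1; rewrite (minn_idPr _); last by rewrite ltnW// ltn_ceil.
  by apply => //; exact: leqW.
elim: j => [|j IH]; rewrite leq_eqVlt => /predU1P[kj|].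
- by move=> _; rewrite kj mul0n min0n !word_sum0 /renorm !big_ord0.
- by rewrite ltn0.
- move=> jN; rewrite -kj (minn_idPl _); last by rewrite -leq_divRL.
  apply: eq_word_sum => u su; rewrite take_oversize ?su//; congr (_ * _).
  by apply: eq_renorm => K Kk; apply: block_len; exact: leq_trans Kk kN.
- rewrite ltnS => kj jN; rewrite block_end//.
  rewrite (_ : word_sum _ _ = word_sum (j * M + m j) (fun v => renorm m M j.+1 v y *
      g (take (k * M) (take (j * M) v)))); last first.
    by apply: eq_word_sum => v sv; rewrite take_takel// leq_mul2r kj orbT.
  rewrite (@sum_renormS m M j (fun v => g (take (k * M) v))); last by move=> *; exact: block_len_le.
  rewrite -IH//; last exact: ltnW.
  by rewrite (minn_idPl _)// -leq_divRL.
Qed.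

Lemma sum_renorm_total y : word_sum N (fun v => renorm m M (N %/ M).+1 v y) = 1.
Proof.
have := @sum_renorm_marginal 0 (fun=> 1) y (leq0n _).
rewrite mul0n word_sum0 [in RHS]/renorm big_ord0 mulr1 => H.
by rewrite -[RHS]H; apply: eq_word_sum => v _; rewrite mulr1.
Qed.

(** The numerators of the Gibbs weights multiply up to the weight of the whole path, so only the
    partition functions of the visited blocks remain. *)
Lemma renormE v y : size v = N ->
  renorm m M (N %/ M).+1 v y =
  path_weight v [::] y / \prod_(K < (N %/ M).+1) part_fun (m K) (take (K * M) v) y.
Proof.
move=> sv; rewrite /renorm prodf_div; congr (_ / _).
suff H k : (k <= (N %/ M).+1)%N ->
    \prod_(K < k) path_weight (take (m K) (drop (K * M) v)) (take (K * M) v) y =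
    path_weight (take (minn (k * M) N) v) [::] y.
  by rewrite H// take_oversize// sv (minn_idPr _)// ltnW// ltn_ceil.
elim: k => [|k IH] kN; first by rewrite big_ord0 min0n take0.
rewrite big_ord_recr/= IH; last exact: ltnW.
rewrite block_end// takeD path_weight_cat cat0s.
by rewrite (minn_idPl _)// -leq_divRL.
Qed.

End Blocks.

(* When [M] divides [N] the last block is empty and contributes [ln 1 = 0]. *)
Definition kl N M y : R := ln (part_fun N [::] y) - \sum_(K < (N %/ M).+1)
  word_sum (K * M) (fun u =>
    renorm (fun=> M) M K u y * ln (part_fun (minn M (N - K * M)) u y)).

End PartitionFunction.

Lemma ln_prod (R : realType) k (F : 'I_k -> R) : (forall i, 0 < F i) ->
  ln (\prod_(i < k) F i) = \sum_(i < k) ln (F i).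
Proof.
elim: k F => [|k IH] F F0; first by rewrite !big_ord0 ln1.
rewrite !big_ord_recr/= lnM ?posrE//; first by rewrite IH.
by apply: prodr_gt0.
Qed.

(** * The divergence as a functional of the environment *)

Section Translation.
Context {dT : measure_display} {T : measurableType dT} {R : realType}.
Variables (P : probability T R) (d : nat) (Yv : seq 'I_d -> 'I_d -> T -> R).
Variable (beta : R).
Hypothesis d_gt0 : (0 < d)%N.
Local Notation f := (phi P Yv beta).
Local Notation envY := (env_of Yv).
Local Notation Z := (part_fun beta f).

Lemma Xv_rcons v i x : Xv Yv (rcons v i) x = Xv Yv v x + Yv v i x.
Proof.
have XvE w : Xv Yv w x = \sum_(k < size w) Yv (take k w) (nth i w k) x.
  by apply: eq_bigr => k _; rewrite (tnth_nth i).
rewrite !XvE size_rcons big_ord_recr/=; congr (_ + _).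
  apply: eq_bigr => -[k kv] _ /=.
  by rewrite nth_rcons kv -cats1 takel_cat// ltnW.
by rewrite nth_rcons ltnn eqxx -cats1 take_size_cat.
Qed.

Lemma path_weightE v w x : expR (beta * Xrel Yv v w x - f * (size w)%:R) =
  path_weight beta f w v (envY x).
Proof.
elim: w v => [|i w IH] v /=.
  by rewrite /Xrel cats0 subrr !mulr0 subrr expR0.
rewrite -IH /edge_weight -expRD; congr expR.
rewrite /Xrel cat_rcons Xv_rcons /env_of -[(size w).+1]addn1 natrD.
ring.
Qed.

Lemma WrelE v n x : Wrel P Yv beta v n x = Z n v (envY x).
Proof.
rewrite part_funE; apply: eq_bigr => w _.
by rewrite -path_weightE size_tuple.
Qed.

Lemma Xv_nil x : Xv Yv [::] x = 0.
Proof. by rewrite /Xv big_ord0. Qed.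

Lemma WE n x : W P Yv beta n x = Z n [::] (envY x).
Proof.
rewrite -WrelE; apply: eq_bigr => w _.
by rewrite /Xrel Xv_nil subr0.
Qed.

Lemma mu_relE v n u x : size u = n ->
  mu_rel P Yv beta v n u x = gibbs beta f n v u (envY x).
Proof.
by move=> su; rewrite /mu_rel path_weightE !WrelE su subnn mulr1.
Qed.

Lemma muE N v x : size v = N -> mu P Yv beta N v x =
  path_weight beta f v [::] (envY x) / Z N [::] (envY x).
Proof.
move=> sv; rewrite /mu WE WrelE sv subnn mulr1; congr (_ / _).
by rewrite -path_weightE /Xrel Xv_nil subr0 sv.
Qed.

Section FixedBlocks.
Variables (M N : nat).
Hypothesis M_gt0 : (0 < M)%N.
Let m K := minn M (N - K * M).

Lemma muMNE v x : size v = N ->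
  muMN P Yv beta M N v x = renorm beta f m M (N %/ M).+1 v (envY x).
Proof.
move=> sv; apply: eq_bigr => K _; apply: mu_relE.
by rewrite size_take size_drop sv; case: ltnP => // h; apply/eqP; rewrite eqn_leq h geq_minr.
Qed.

Lemma DKLE x : DKL P Yv beta M N x = kl beta f N M (envY x).
Proof.
rewrite /kl.
set y := envY x; set k := (N %/ M).+1.
transitivity (word_sum N (fun v => renorm beta f m M k v y * ln (Z N [::] y) -
    \sum_(K < k) renorm beta f m M k v y * ln (Z (m K) (take (K * M) v) y))).
  apply: eq_bigr => v _; have sv := size_tuple v; rewrite muMNE// muE// -/y -/k -mulr_sumr -mulrBr.
  congr (_ * _); rewrite renormE// -/k.
  set pr := \prod_(_ < _) _.
  have pr0 : 0 < pr by apply: prodr_gt0 => K _; apply: part_fun_gt0.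
  have -> : path_weight beta f v [::] y / pr /
     (path_weight beta f v [::] y / Z N [::] y) = Z N [::] y / pr.
    by field; rewrite !gt_eqF ?path_weight_gt0 ?part_fun_gt0.
  rewrite ln_div ?posrE ?part_fun_gt0//; congr (_ - _).
  by rewrite /pr ln_prod// => K; apply: part_fun_gt0.
rewrite [LHS]sumrB; congr (_ - _).
  transitivity (word_sum N (fun v => renorm beta f m M k v y) * ln (Z N [::] y)).
    by rewrite /word_sum mulr_suml.
  by rewrite [X in X * _](sum_renorm_total _ _ d_gt0 N M_gt0) mul1r.
rewrite exchange_big; apply: eq_bigr => K _ /=.
apply: (@sum_renorm_marginal _ _ _ _ d_gt0 M N M_gt0 K (fun u => ln (Z (m K) u y))).
by rewrite -ltnS.
Qed.

End FixedBlocks.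
End Translation.

(** * Moments of the partition function *)

Section RealInequalities.
Context {R : realType}.
Implicit Types (x y t p r : R).

(** The inequality [ln (t / p) <= t / p] gives [p ln t <= p ln p + t], so the constant is $p^p$. *)
Lemma powR_le_expR p : 0 <= p -> exists2 C, 0 < C & forall t, 0 <= t ->
  t `^ p <= C * expR t.
Proof.
move=> p0; exists (expR (p * ln p)); first exact: expR_gt0.
move=> t t0; rewrite -expRD.
have [->|pN0] := eqVneq p 0.
  by rewrite powRr0 mul0r add0r -expR0 ler_expR.
have [->|tN0] := eqVneq t 0; first by rewrite powR0// expR_ge0.
have tgt0 : 0 < t by rewrite lt_def tN0.
have pgt0 : 0 < p by rewrite lt_def pN0.
rewrite /powR (negbTE tN0) ler_expR.
have : ln (t / p) <= t / p.
  by rewrite ltW// ln_sublinear// divr_gt0.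
rewrite ln_div ?posrE// -(ler_pM2l pgt0) mulrBr lerBlDl.
by rewrite [p * (t / p)]mulrC divfK.
Qed.

(** Convexity between 0 and [x], obtained by weighting the tangent inequalities at [t * x] with [t]
    and [1 - t]. It makes an exponential moment close to 1 when [t] is small. *)
Lemma expR_convex01 x t : 0 <= t <= 1 -> expR (t * x) <= 1 + t * expR x.
Proof.
move=> /andP[t0 t1].
have e1 : 1 + (1 - t) * x <= expR ((1 - t) * x) by exact: expR_ge1Dx.
have e0 : 1 + (- t * x) <= expR (- t * x) by exact: expR_ge1Dx.
have E0 := expR_ge0 (t * x).
have X1 : expR x = expR (t * x) * expR ((1 - t) * x).
  by rewrite -expRD; congr expR; ring.
have X0 : 1 = expR (t * x) * expR (- t * x).
  by rewrite -expRD mulNr subrr expR0.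
have h1 : expR (t * x) * (1 + (1 - t) * x) <= expR x by rewrite X1 ler_wpM2l.
have h0 : expR (t * x) * (1 + (- t * x)) <= 1 by rewrite [leRHS]X0 ler_wpM2l.
have h1' := ler_wpM2l t0 h1.
have h0' : (1 - t) * (expR (t * x) * (1 + (- t * x))) <= (1 - t) * 1.
  by apply: ler_wpM2l h0; rewrite subr_ge0.
nra.
Qed.

(** The shares [x i / S] lie in [0, 1], so each is at most its power of order [r], and the shares
    sum to 1. *)
Lemma powR_sum_le (I : finType) (x : I -> R) r : 0 < r -> r <= 1 ->
  (forall i, 0 <= x i) -> (\sum_i x i) `^ r <= \sum_i x i `^ r.
Proof.
move=> r0 r1 x0; set S := \sum_i x i.
have S0 : 0 <= S by exact: sumr_ge0.
have [S0'|SN0] := eqVneq S 0.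
  by rewrite S0' powR0 ?gt_eqF//; apply: sumr_ge0 => i _; exact: powR_ge0.
have Sp : 0 < S by rewrite lt_def SN0.
rewrite -[leLHS]mul1r -(divff SN0) {1}/S !mulr_suml; apply: ler_sum => i _.
rewrite [leRHS](_ : _ = (x i / S) `^ r * S `^ r); last first.
  by rewrite -powRM ?divr_ge0// divfK.
apply: ler_wpM2r; first exact: powR_ge0.
have [->|xN0] := eqVneq (x i) 0; first by rewrite mul0r powR_ge0.
have xS : x i / S <= 1.
  by rewrite ler_pdivrMr// mul1r /S (bigD1 i)//= lerDl sumr_ge0.
rewrite -[leLHS]powRr1 ?divr_ge0//.
by apply: ger_powR => //; rewrite xS divr_gt0// lt_def xN0 x0.
Qed.

Lemma powR1Dr x r : 0 <= x -> 0 < r -> x `^ (1 + r) = x * x `^ r.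
Proof.
by move=> x0 r0; rewrite powRD ?powRr1//; rewrite gt_eqF// addr_gt0.
Qed.

Lemma powR_sum_le_cross (I : finType) (x : I -> R) r : 0 < r -> r <= 1 ->
  (forall i, 0 <= x i) ->
  (\sum_i x i) `^ (1 + r) <= \sum_i \sum_j x i * x j `^ r.
Proof.
move=> r0 r1 x0; rewrite powR1Dr ?sumr_ge0// mulr_suml; apply: ler_sum => i _.
by rewrite -mulr_sumr ler_wpM2l// powR_sum_le.
Qed.

(** Jensen's inequality, by averaging the tangent to the exponential at the mean [m]. *)
Lemma expR_weighted_le (I : finType) (p x : I -> R) :
  (forall i, 0 <= p i) -> \sum_i p i = 1 ->
  expR (\sum_i p i * x i) <= \sum_i p i * expR (x i).
Proof.
move=> p0 p1; set m := \sum_i p i * x i.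
have -> : expR m = \sum_i p i * (expR m * (1 + (x i - m))).
  under eq_bigr do rewrite mulrCA.
  rewrite -mulr_sumr; under eq_bigr do rewrite mulrDr mulr1 mulrBr.
  by rewrite big_split /= sumrB -mulr_suml p1 mul1r subrr addr0 mulr1.
apply: ler_sum => i _; apply: ler_wpM2l => //.
rewrite (_ : expR (x i) = expR m * expR (x i - m)).
  by rewrite ler_pM2l ?expR_gt0// expR_ge1Dx.
by rewrite -expRD; congr expR; ring.
Qed.

Lemma powR_abs_le_expR (s q : R) : 0 < s -> 0 <= q ->
  exists2 C, 0 < C & forall x : R, `|x| `^ q <= C * expR (s * `|x|).
Proof.
move=> s0 q0; have [C C0 HC] := powR_le_expR q0.
have sq0 : 0 < s^-1 `^ q by rewrite powR_gt0// invr_gt0.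
exists (s^-1 `^ q * C); first exact: mulr_gt0.
move=> x; rewrite -mulrA (_ : `|x| `^ q = s^-1 `^ q * (s * `|x|) `^ q).
  by rewrite ler_pM2l// HC// mulr_ge0// ltW.
by rewrite -powRM ?mulr_ge0// ?invr_ge0 ?(ltW s0)// mulKf// gt_eqF.
Qed.

Lemma abs_le_expR (s x : R) : 0 < s -> `|x| <= s^-1 * expR (s * `|x|).
Proof.
move=> s_gt0; rewrite ler_pdivlMl//; apply: le_trans (expR_ge1Dx _).
by rewrite lerDr.
Qed.

Lemma geometric_sum_le (q : R) k : 0 <= q < 1 -> \sum_(K < k) q ^+ K <= (1 - q)^-1.
Proof.
move=> /andP[q0 q1]; have q1' : 0 < 1 - q by rewrite subr_gt0.
rewrite -(ler_pM2l q1') mulfV ?lt0r_neq0//.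
have := subrX1 q k; have := exprn_ge0 k q0; lra.
Qed.

End RealInequalities.

Section Estimates.
Context {R : realType} {d : nat}.
Variable Q : probability (@sigma_env R d predT) R.
Hypothesis iidQ : iid_law Q.
Local Notation V := (seq 'I_d).
Local Notation env := (@env R d).
Hypothesis d_ge2 : (2 <= d)%N.
Variables (b f : R).
Local Notation a := (edge_weight b f).
Local Notation Z := (part_fun b f).
Local Notation E := (EQ Q).
Local Notation E_le := (EQ_le Q).
Local Notation L1 := (L1 Q).
Implicit Types (v w u : V) (y : env) (n : nat).

Let d_gt0 : (0 < d)%N. Proof. exact: ltnW. Qed.
Let i0 : 'I_d := Ordinal d_gt0.
Let i1 : 'I_d := Ordinal d_ge2.

Hypothesis edge1 : (forall i, L1 (a [::] i)) /\ \sum_i E (a [::] i) = 1.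
Variables (r ka : R).
Hypotheses (r_gt0 : 0 < r) (r_le1 : r <= 1) (ka_lt1 : ka < 1).
Hypothesis edge_r : (forall i, L1 (fun y => a [::] i y `^ (1 + r))) /\
  \sum_i E (fun y => a [::] i y `^ (1 + r)) <= ka.
Variables (s0 B0 : R).
Hypotheses (s0_gt0 : 0 < s0).
Hypothesis edge_exp : forall i, E_le (fun y => expR (s0 * `|b * y [::] i - f|)) B0.

Let Z_gt0 n v y : 0 < Z n v y. Proof. exact: part_fun_gt0. Qed.

Lemma E_le_shift v (F : env -> R) c : E_le F c -> E_le (F \o shift_env v) c.
Proof. by move=> [iF Fc]; have [iFs EFs] := EQ_shift iidQ v iF; split; rewrite ?EFs. Qed.

Lemma shift_coord v i (F : R -> R) :
  (fun y : env => F (y v i)) = (fun y => F (y [::] i)) \o shift_env v.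
Proof. by apply/funext => y /=; rewrite /shift_env cats0. Qed.

Lemma E_le_coord v i (F : R -> R) c :
  E_le (fun y => F (y [::] i)) c -> E_le (fun y => F (y v i)) c.
Proof. by move=> Fc; rewrite shift_coord; exact: E_le_shift. Qed.

Lemma edge1_at v : (forall i, L1 (a v i)) /\ \sum_i E (a v i) = 1.
Proof.
have [i1' E1] := edge1; have sh i := EQ_shift iidQ v (i1' i).
have aE i : a v i = a [::] i \o shift_env v.
  exact: (shift_coord v i (fun t => expR (b * t - f))).
split=> [i|]; first by rewrite aE; case: (sh i).
by rewrite -E1; apply: eq_bigr => i _; rewrite aE; case: (sh i).
Qed.

Lemma edge_r_at v i : E_le (fun y => a v i y `^ (1 + r)) (E (fun y => a [::] i y `^ (1 + r))).
Proof.
apply: (@E_le_coord v i (fun t => expR (b * t - f) `^ (1 + r))).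
by have [ir _] := edge_r; split; [exact: ir|exact: lexx].
Qed.

Lemma edge_exp_at v i : E_le (fun y => expR (s0 * `|b * y v i - f|)) B0.
Proof. exact: (@E_le_coord v i (fun t => expR (s0 * `|b * t - f|))). Qed.

Lemma edge_r_le1 v i : E_le (fun y => a v i y `^ (1 + r)) 1.
Proof.
apply: EQ_le_trans (edge_r_at v i) _; apply: le_trans (ltW ka_lt1).
case: edge_r => _; apply: le_trans; rewrite (bigD1 i)//= lerDl sumr_ge0// => j _.
by apply: EQ_ge0 => y; exact: powR_ge0.
Qed.

Lemma self_subtree_disjoint v i n u : pred1 v u -> subtree (rcons v i) n u -> False.
Proof.
by move=> /eqP -> /subtree_prefix /size_prefix; rewrite size_rcons ltnn.
Qed.

Lemma prefix_disjoint v w u : size v = size w -> v != w ->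
  prefix v u -> prefix w u -> False.
Proof.
move=> vw /eqP vNw /prefixP[s uE] /prefixP[s' uE']; apply: vNw.
by rewrite -(take_size_cat s (erefl (size v))) -uE uE' vw take_size_cat.
Qed.

Lemma siblings_disjoint v i j n u : i != j ->
  subtree (rcons v i) n u -> subtree (rcons v j) n u -> False.
Proof.
move=> ij /subtree_prefix pi /subtree_prefix; apply: prefix_disjoint pi.
  by rewrite !size_rcons.
by apply: contra ij => /eqP /rcons_inj[->].
Qed.

Lemma edge_depends v i : depends_on (pred1 v) (a v i).
Proof. by apply: depends_on_edge_weight; rewrite /= eqxx. Qed.

Lemma meas_part_fun n v : depends_on predT (Z n v).
Proof. exact: (depends_on_meas (@depends_on_part_fun R d b f n v)). Qed.

Lemma E_part_fun n v : L1 (Z n v) /\ E (Z n v) = 1.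
Proof.
elim: n v => [|n IH] v; first by split; [exact: L1_cst|rewrite EQ_cst].
have [ia Ea] := edge1_at v.
have H i := EQ_indep_ge0 iidQ (@self_subtree_disjoint v i n) (@edge_depends v i)
  (@depends_on_part_fun R d b f n (rcons v i)) (fun y => ltW (edge_weight_gt0 b f v i y))
  (fun y => part_fun_ge0 b f n (rcons v i) y) (ia i) (proj1 (IH (rcons v i))).
split; first by apply: L1_sum => i; case: (H i).
rewrite EQ_sum; last by move=> i; case: (H i).
rewrite -[RHS]Ea; apply: eq_bigr => i _; have [_ ->] := H i.
by have [_ ->] := IH (rcons v i); rewrite mulr1.
Qed.

(** The subtrees of two distinct children are independent of each other, and their union is
    independent of the vector at [v]. *)
Lemma E_le_three v i j n (F G H : env -> R) c1 c2 c3 : i != j ->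
  depends_on (pred1 v) F -> depends_on (subtree (rcons v i) n) G ->
  depends_on (subtree (rcons v j) n) H ->
  (forall y, 0 <= F y) -> (forall y, 0 <= G y) -> (forall y, 0 <= H y) ->
  E_le F c1 -> E_le G c2 -> E_le H c3 ->
  E_le (fun y => F y * (G y * H y)) (c1 * (c2 * c3)).
Proof.
move=> ij dF dG dH F0 G0 H0 Fc Gc Hc.
pose AB := [pred u | subtree (rcons v i) n u || subtree (rcons v j) n u].
apply: (EQ_leM iidQ (A := pred1 v) (B := AB)) => //.
- by move=> u uv /orP[]; exact: self_subtree_disjoint uv.
- apply: depends_onM; first by apply: depends_on_sub dG => u; rewrite !inE => uA; apply/orP; left.
  by apply: depends_on_sub dH => u; rewrite !inE => uA; apply/orP; right.
- by move=> y; rewrite mulr_ge0.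
- apply: (EQ_leM iidQ (A := subtree (rcons v i) n) (B := subtree (rcons v j) n)) => //.
  by move=> u; exact: siblings_disjoint.
Qed.

Lemma E_part_fun_small_pow n v : E_le (fun y => Z n v y `^ r) 2.
Proof.
have [iZ EZ] := E_part_fun n v.
apply: (@EQ_le_mono _ _ _ _ (fun y => 1 + Z n v y)).
- by apply: depends_on_powR; exact: meas_part_fun.
- move=> y; rewrite powR_ge0 /=; have Z0 := ltW (Z_gt0 n v y).
  have [Z1|Z1] := leP (Z n v y) 1.
    apply: (@le_trans _ _ 1); last by rewrite lerDl.
    by have := @ge0_ler_powR R r (ltW r_gt0) (Z n v y) 1; rewrite powR1; apply; rewrite ?nnegrE.
  apply: (@le_trans _ _ (Z n v y)); last by rewrite lerDr.
  by apply: ler1_powR => //; exact: ltW.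
- by apply: EQ_leD (EQ_le_cst _ _) _; split; rewrite ?EZ.
Qed.

(* In [sum_ij x_i x_j^r] the diagonal contracts by [ka < 1]; the off-diagonal terms factor into
   moments of order at most 1. *)
Lemma E_part_fun_pow : exists2 C, 0 < C &
  forall n v, E_le (fun y => Z n v y `^ (1 + r)) C.
Proof.
pose D : R := 4 * (d * d)%:R.
have D0 : 0 <= D by rewrite mulr_ge0.
have ka1 : 0 < 1 - ka by rewrite subr_gt0.
(* One generation turns the bound [C] into [ka * C + D], whose fixed point is [D / (1 - ka)]. Adding
   1 keeps the bound stable, as [ka < 1], and covers depth 0. *)
pose C := 1 + D / (1 - ka).
have C0 : 0 < C by rewrite ltr_pwDl// divr_ge0// ltW.
exists C => //; elim => [|n IH] v.
  rewrite [X in E_le X](_ : _ = fun=> 1); last by apply/funext => y; rewrite /= powR1.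
  by apply: EQ_le_trans (EQ_le_cst _ 1) _; rewrite lerDl divr_ge0// ltW.
pose e i := E (fun y => a [::] i y `^ (1 + r)).
pose G i j y := (a v i y * a v j y `^ r) * (Z n (rcons v i) y * Z n (rcons v j) y `^ r).
have a0 i y : 0 <= a v i y by rewrite ltW// edge_weight_gt0.
have Z0 i y : 0 <= Z n (rcons v i) y by rewrite ltW.
have GE i j : E_le (G i j) ((if i == j then e i * C else 0) + 4).
  have [<-|ij] := eqVneq i j.
    rewrite (_ : G i i = fun y => a v i y `^ (1 + r) * Z n (rcons v i) y `^ (1 + r)).
      apply: (@EQ_le_trans _ _ _ _ (e i * C)); last by rewrite lerDl.
      apply: (EQ_leM iidQ (A := pred1 v) (B := subtree (rcons v i) n)
        (F := fun y => a v i y `^ (1 + r)) (G := fun y => Z n (rcons v i) y `^ (1 + r))).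
      - by move=> u; exact: self_subtree_disjoint.
      - by apply: depends_on_powR; exact: edge_depends.
      - by apply: depends_on_powR; exact: depends_on_part_fun.
      - by move=> y; exact: powR_ge0.
      - by move=> y; exact: powR_ge0.
      - exact: edge_r_at.
      - exact: IH.
    by apply/funext => y; rewrite /G !powR1Dr.
  (* The factors bound the means of [a_i a_j^r], at most that of [a_i^(1+r) + a_j^(1+r)], of [Z] at
     child [i], and of [Z^r] at child [j]. *)
  rewrite add0r (_ : 4 = 2 * (1 * 2)); last by ring.
  apply: (E_le_three (i := i) (j := j) (v := v) (n := n)) => //.
  - by apply: depends_onM; [|apply: depends_on_powR]; exact: edge_depends.
  - exact: depends_on_part_fun.
  - by apply: depends_on_powR; exact: depends_on_part_fun.
  - by move=> y; rewrite mulr_ge0// powR_ge0.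
  - by move=> y; exact: powR_ge0.
  - apply: (@EQ_le_mono _ _ _ _ (fun y => a v i y `^ (1 + r) + a v j y `^ (1 + r))).
    + apply: (@depends_on_meas _ _ (pred1 v)).
      by apply: depends_onM; [|apply: depends_on_powR]; exact: edge_depends.
    + move=> y; rewrite mulr_ge0 ?powR_ge0//=.
      have pE i' : a v i' y `^ (1 + r) = a v i' y * a v i' y `^ r.
        by rewrite powR1Dr.
      have [aij|aji] := leP (a v i y) (a v j y).
        apply: (@le_trans _ _ (a v j y `^ (1 + r))); last by rewrite lerDr powR_ge0.
        by rewrite pE ler_wpM2r// powR_ge0.
      apply: (@le_trans _ _ (a v i y `^ (1 + r))); last by rewrite lerDl powR_ge0.
      by rewrite pE ler_wpM2l//; apply: ge0_ler_powR; rewrite ?nnegrE// ltW.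
    + by rewrite -[2]/(1 + 1); apply: EQ_leD; exact: edge_r_le1.
  - by have [iZ EZ] := E_part_fun n (rcons v i); split; rewrite ?EZ.
  - exact: E_part_fun_small_pow.
apply: (@EQ_le_mono _ _ _ _ (fun y => \sum_i \sum_j G i j y)).
- by apply: depends_on_powR; exact: meas_part_fun.
- move=> y; rewrite powR_ge0 /=.
  have := @powR_sum_le_cross R _ (fun i => a v i y * Z n (rcons v i) y) r r_gt0 r_le1.
  move=> /(_ _)/le_trans; apply; first by move=> i; rewrite mulr_ge0.
  apply: ler_sum => i _; apply: ler_sum => j _.
  by rewrite powRM// /G mulrACA.
- apply: (@EQ_le_trans _ _ _ _ (\sum_(i < d) \sum_(j < d) ((if i == j then e i * C else 0) + 4))).
    by apply: EQ_le_sum => i; apply: EQ_le_sum => j; exact: GE.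
  have -> : \sum_(i < d) \sum_(j < d) ((if i == j then e i * C else 0) + 4) =
      (\sum_i e i) * C + D.
    under eq_bigr do rewrite big_split /= sumr_const card_ord.
    rewrite big_split /= sumr_const card_ord -mulrnA -[_ *+ (d * d)]mulr_natr.
    congr (_ + _); rewrite mulr_suml; apply: eq_bigr => i _.
    by rewrite -big_mkcond/= (big_pred1 i)// => j; rewrite eq_sym.
  have eka : (\sum_i e i) * C <= ka * C by apply: ler_wpM2r; [exact: ltW|case: edge_r].
  apply: (@le_trans _ _ (ka * C + D)); first by rewrite lerD2r.
  rewrite /C mulrDr mulr1 [ka * (_ / _)]mulrA -subr_ge0.
  have -> : 1 + D / (1 - ka) - (ka + ka * D / (1 - ka) + D) = 1 - ka.
    by field; rewrite gt_eqF.
  exact: ltW.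
Qed.

End Estimates.

(** * Exponential moments of the log-partition function and Gibbs collisions *)

Section LogMoments.
Context {R : realType} {d : nat}.
Variable Q : probability (@sigma_env R d predT) R.
Hypothesis iidQ : iid_law Q.
Local Notation V := (seq 'I_d).
Local Notation env := (@env R d).
Hypothesis d_ge2 : (2 <= d)%N.
Variables (b f : R).
Local Notation a := (edge_weight b f).
Local Notation Z := (part_fun b f).
Local Notation E := (EQ Q).
Local Notation E_le := (EQ_le Q).
Local Notation L1 := (L1 Q).
Implicit Types (v w u : V) (y : env) (n : nat).

Let d_gt0 : (0 < d)%N. Proof. exact: ltnW. Qed.
Let i0 : 'I_d := Ordinal d_gt0.
Let i1 : 'I_d := Ordinal d_ge2.

Hypothesis mean1 : forall n v, L1 (Z n v) /\ E (Z n v) = 1.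
Variables (r Cr : R).
Hypotheses (r_gt0 : 0 < r) (Cr_gt0 : 0 < Cr).
Hypothesis pow_bound : forall n v, E_le (fun y => Z n v y `^ (1 + r)) Cr.
Variables (s0 B0 : R).
Hypotheses (s0_gt0 : 0 < s0).
Hypothesis edge_exp : forall v i, E_le (fun y => expR (s0 * `|b * y v i - f|)) B0.

Let Z_gt0 n v y : 0 < Z n v y. Proof. exact: part_fun_gt0. Qed.
Let A v i y : R := `|b * y v i - f|.
Let L n v y : R := Num.max (- ln (Z n v y)) 0.

Let A_depends v i : depends_on (pred1 v) (A v i).
Proof.
apply: depends_on_normr; apply: depends_onB; last exact: depends_on_cst.
apply: depends_onM; first exact: depends_on_cst.
by apply: depends_on_coord; rewrite /= eqxx.
Qed.

Let L_depends n v : depends_on (subtree v n) (L n v).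
Proof.
apply: depends_on_max; rewrite (_ : (fun y => _) = fun y => 0 - ln (Z n v y)).
  by apply: depends_onB; [exact: depends_on_cst|exact: depends_on_ln_part_fun].
by apply/funext => y; rewrite sub0r.
Qed.

(** A bounded moment of order [1 + r] caps the mean carried by large values, so a variable of mean 1
    cannot stay near 0. Truncation at [K] gives the explicit value [1 - (2 * K)^-1]. *)
Lemma part_fun_small_prob : exists2 q, 0 <= q < 1 &
  forall n v, E_le (fun y => (Z n v y <= 4^-1)%R%:R) q.
Proof.
pose K := (4 * Cr) `^ r^-1.
have C4 : 0 < 4 * Cr by rewrite mulr_gt0.
have K0 : 0 < K by exact: powR_gt0.
have Kr : K `^ r = 4 * Cr by rewrite /K -powRrM mulVf ?gt_eqF// powRr1// ltW.
have P n v : E_le (fun y => (Z n v y <= 4^-1)%R%:R) (1 - (2 * K)^-1).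
  have [iZ EZ] := mean1 n v; have [iP EP] := pow_bound n v.
  have mI : depends_on predT (fun y => (Z n v y <= 4^-1)%R%:R).
    by apply: depends_on_le; exact: meas_part_fun.
  have iI : L1 (fun y => (Z n v y <= 4^-1)%R%:R).
    apply: (L1_le mI _ (L1_cst Q 1)) => y; rewrite ger0_norm//.
    by case: (Z n v y <= 4^-1)%R.
  split => //.
  have iK := L1Z K iI; have iC := L1Z (4 * Cr)^-1 iP.
  have iK' := L1_cst Q (4^-1 + K).
  (* [Z + K 1_{Z <= 1/4} <= 1/4 + K + Z^(1+r) / (4 Cr)], by the choice [K^r = 4 Cr]. *)
  have : E (fun y => Z n v y + K * (Z n v y <= 4^-1)%R%:R) <=
      E (fun y => 4^-1 + K + (4 * Cr)^-1 * Z n v y `^ (1 + r)).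
    apply: EQ_mono; [exact: L1D|exact: L1D|move=> y].
    have T0 : 0 <= (4 * Cr)^-1 * Z n v y `^ (1 + r).
      by rewrite mulr_ge0 ?powR_ge0// invr_ge0 ltW.
    have [Z4|Z4] := leP (Z n v y) 4^-1; first by rewrite mulr1; lra.
    rewrite mulr0 addr0; have [ZK|KZ] := leP (Z n v y) K; first lra.
    have : Z n v y <= (4 * Cr)^-1 * Z n v y `^ (1 + r).
      rewrite powR1Dr ?(ltW (Z_gt0 _ _ _))// mulrCA ler_peMr ?(ltW (Z_gt0 _ _ _))//.
      rewrite ler_pdivlMl// mulr1 -Kr; apply: ge0_ler_powR; rewrite ?nnegrE ?ltW//.
    by lra.
  rewrite (EQD iZ iK) (EQD iK' iC) EQ_cst !EQZ// EZ => H.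
  have CE : (4 * Cr)^-1 * E (fun y => Z n v y `^ (1 + r)) <= 4^-1.
    by rewrite ler_pdivrMl// mulrC mulrA mulVf// mul1r.
  rewrite -(ler_pM2l K0) mulrBr mulr1 (_ : K * (2 * K)^-1 = 2^-1); last first.
    by field; rewrite gt_eqF.
  by lra.
exists (1 - (2 * K)^-1) => //; apply/andP; split.
  have [_] := P 0%N [::]; apply: le_trans; apply: EQ_ge0 => y.
  exact: ler0n.
by rewrite ltrBlDr ltrDl invr_gt0 mulr_gt0.
Qed.

Let B0_ge0 : 0 <= B0.
Proof.
have [_] := edge_exp [::] i0; apply: le_trans; apply: EQ_ge0 => y; exact: expR_ge0.
Qed.

Let L_ge0 n v y : 0 <= L n v y.
Proof. by rewrite /L le_max lexx orbT. Qed.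

Let A_ge0 v i y : 0 <= A v i y. Proof. exact: normr_ge0. Qed.

(** Keeping the single child [i] in the recursion bounds the partition function from below; the
    child can be chosen according to the environment. *)
Let L_rec n v i y : L n.+1 v y <= A v i y + L n (rcons v i) y.
Proof.
have ai0 := edge_weight_gt0 b f v i y; have Zi0 := Z_gt0 n (rcons v i) y.
rewrite {1}/L ge_max addr_ge0// andbT.
have : a v i y * Z n (rcons v i) y <= Z n.+1 v y.
  rewrite /= (bigD1 i)//= lerDl sumr_ge0// => j _.
  by rewrite mulr_ge0 ?part_fun_ge0// ltW// edge_weight_gt0.
rewrite -ler_ln ?posrE ?mulr_gt0// lnM ?posrE// expRK => H.
have H1 : - (b * y v i - f) <= A v i y by rewrite /A -normrN ler_norm.
have H2 : - ln (Z n (rcons v i) y) <= L n (rcons v i) y by rewrite /L le_max lexx.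
by move: H; rewrite -lerN2 opprD => /le_trans; apply; exact: lerD.
Qed.

Lemma E_part_fun_neg_exp : exists s C, [/\ 0 < s <= 1, 0 < C &
  forall n v, E_le (fun y => expR (s * L n v y)) C].
Proof.
have [q /andP[q0 q1] Pq] := part_fun_small_prob.
(* Chosen so that [B = 1 + 2 * (th * B0)] is at most [1 + (1 - q) / 2], whence [B * q < 1]. *)
pose th := (1 - q) / (4 * B0 + 2).
have B00 : 0 <= B0 := B0_ge0.
have D0 : 0 < 4 * B0 + 2 by lra.
have th0 : 0 < th by rewrite divr_gt0// subr_gt0.
have th1 : th <= 1 by rewrite ler_pdivrMr// mul1r; lra.
have thB : 2 * (th * B0) <= (1 - q) / 2.
  rewrite /th; have : (1 - q) / (4 * B0 + 2) * (4 * B0 + 2) = 1 - q by rewrite divfK// gt_eqF.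
  by rewrite -/th; nra.
(* Two edges are controlled at once: [2 * s1 <= s0] bounds [s1] times the sum of their terms by [s0]
   times the larger. Also [s1 <= 1] ensures [s <= 1], which the upper tail requires. *)
pose s1 := s0 / (2 * (1 + s0)).
have s0p : 0 < s0 := s0_gt0.
have s1D : 0 < 2 * (1 + s0) by lra.
have s10 : 0 < s1 by rewrite divr_gt0.
have s1s0 : 2 * s1 <= s0.
  rewrite /s1 mulrA ler_pdivrMr//; nra.
have s11 : s1 <= 1 by rewrite ler_pdivrMr//; lra.
pose s := th * s1.
have s_gt0 : 0 < s by rewrite mulr_gt0.
have s_le1 : s <= 1 by rewrite mulr_ile1// ltW.
pose B := 1 + 2 * (th * B0).
have B_ge1 : 1 <= B by have := mulr_ge0 (ltW th0) B00; rewrite /B; lra.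
have Bq : B * q < 1 by rewrite /B; nra.
pose c4 := expR (s * ln 4).
have c4_gt0 : 0 < c4 by exact: expR_gt0.
(* The recursion sends [C] to [B * (c4 + q * C)], with fixed point [B * c4 / (1 - B * q)]; the extra
   1 covers depth 0 and preserves the inequality because [B * q < 1]. *)
pose C := 1 + B * c4 / (1 - B * q).
have C_ge1 : 1 <= C.
  by rewrite lerDl divr_ge0 ?subr_ge0 ?(ltW Bq)// mulr_ge0 ?(ltW c4_gt0)//; lra.
exists s, C; split; [by rewrite s_gt0|lra|].
elim=> [|n IH] v.
  rewrite (_ : (fun y => _) = fun=> 1).
    by apply: EQ_le_trans (EQ_le_cst _ 1) _.
  by apply/funext => y; rewrite /L /= ln1 oppr0 maxxx mulr0 expR0.
pose F y := expR (s * (A v i0 y + A v i1 y)).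
have F_depends : depends_on (pred1 v) F.
  apply: depends_on_expR; apply: depends_onM; first exact: depends_on_cst.
  by apply: depends_onD; exact: A_depends.
have FB : E_le F B.
  apply: (@EQ_le_mono _ _ _ _ (fun y =>
     1 + th * (expR (s0 * A v i0 y) + expR (s0 * A v i1 y)))).
  - exact: (depends_on_meas F_depends).
  - move=> y; rewrite expR_ge0 /F /s -mulrA.
    apply: le_trans (expR_convex01 _ _) _; first by rewrite (ltW th0) th1.
    rewrite lerD2l ler_pM2l//.
    have E0 := expR_ge0 (s0 * A v i0 y); have E1 := expR_ge0 (s0 * A v i1 y).
    have Ai0 := A_ge0 v i0 y; have Ai1 := A_ge0 v i1 y.
    have [A01|A10] := leP (A v i0 y) (A v i1 y).
      apply: (@le_trans _ _ (expR (s0 * A v i1 y))); last by rewrite lerDr.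
      by rewrite ler_expR; nra.
    apply: (@le_trans _ _ (expR (s0 * A v i0 y))); last by rewrite lerDl.
    by rewrite ler_expR; nra.
  - apply: EQ_le_trans (EQ_leD (EQ_le_cst Q 1) (EQ_leZ (ltW th0)
      (EQ_leD (edge_exp v i0) (edge_exp v i1)))) _.
    by rewrite /B; lra.
pose I y : R := (Z n (rcons v i0) y <= 4^-1)%R%:R.
pose H y := expR (s * L n (rcons v i1) y).
have I_ge0 y : 0 <= I y by exact: ler0n.
(* Either the first child has [Z > 1/4], or [L] is bounded through the second child: this costs
   an independent factor [q]. *)
apply: (@EQ_le_mono _ _ _ _ (fun y => c4 * F y + F y * (I y * H y))).
- apply: depends_on_expR; apply: depends_onM; first exact: depends_on_cst.
  exact: (depends_on_meas (@L_depends n.+1 v)).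
- move=> y; rewrite expR_ge0 /=.
  have F0 := expR_ge0 (s * (A v i0 y + A v i1 y)); rewrite -/(F y) in F0.
  have H0 := expR_ge0 (s * L n (rcons v i1) y); rewrite -/(H y) in H0.
  have [Z4|Z4] := leP (Z n (rcons v i0) y) 4^-1.
    rewrite /I Z4 mul1r; apply: (@le_trans _ _ (F y * H y)); last first.
      by rewrite lerDr mulr_ge0// ltW.
    rewrite /F /H -expRD ler_expR -mulrDr ler_pM2l//.
    apply: le_trans (L_rec n v i1 y) _.
    by have := A_ge0 v i0 y; lra.
  have -> : I y = 0 by rewrite /I leNgt Z4.
  rewrite mul0r mulr0 addr0 /c4 /F -expRD ler_expR -mulrDr ler_pM2l//.
  apply: le_trans (L_rec n v i0 y) _.
  have : L n (rcons v i0) y <= ln 4.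
    rewrite /L ge_max; apply/andP; split; last by rewrite ln_ge0// ler1n.
    by rewrite lerNl -lnV ?posrE// ler_ln ?posrE// ltW.
  by have := A_ge0 v i1 y; lra.
- apply: (@EQ_le_trans _ _ _ _ (c4 * B + B * (q * C))).
    apply: EQ_leD; first exact: EQ_leZ (ltW c4_gt0) FB.
    apply: (@E_le_three _ _ _ iidQ v i0 i1 n) => //.
    + by apply: depends_on_le; exact: depends_on_part_fun.
    + apply: depends_on_expR; apply: depends_onM; first exact: depends_on_cst.
      exact: L_depends.
    + by move=> y; exact: expR_ge0.
    + by move=> y; exact: expR_ge0.
    + exact: Pq.
    + exact: IH.
  rewrite /C -subr_ge0.
  have -> : 1 + B * c4 / (1 - B * q) - (c4 * B + B * (q * (1 + B * c4 / (1 - B * q)))) =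
     1 - B * q.
    by field; rewrite subr_eq0 gt_eqF.
  by rewrite subr_ge0 ltW.
Qed.

(** Where [ln Z] is nonnegative, [s <= 1] gives [exp (s ln Z) <= Z], of mean 1; elsewhere the
    absolute value is the negative part already treated. *)
Lemma E_log_part_fun_exp : exists s C, [/\ 0 < s, 0 < C &
  forall n v, E_le (fun y => expR (s * `|ln (Z n v y)|)) C].
Proof.
have [s [C [/andP[s_gt0 s_le1] C0 HC]]] := E_part_fun_neg_exp.
exists s, (C + 1); split => //; first by rewrite addr_gt0.
move=> n v; have [iZ EZ] := mean1 n v.
apply: (@EQ_le_mono _ _ _ _ (fun y => expR (s * L n v y) + Z n v y)).
- apply: depends_on_expR; apply: depends_onM; first exact: depends_on_cst.
  by apply: depends_on_normr; exact: (depends_on_meas (@depends_on_ln_part_fun R d b f n v)).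
- move=> y; rewrite expR_ge0 /=; have Zp := Z_gt0 n v y.
  have [l0|l0] := leP 0 (ln (Z n v y)).
    apply: (@le_trans _ _ (Z n v y)); last by rewrite lerDr expR_ge0.
    by rewrite ger0_norm// -[leRHS]lnK ?posrE// ler_expR ler_piMl.
  apply: (@le_trans _ _ (expR (s * L n v y))); last by rewrite lerDl ltW.
  rewrite ltr0_norm// ler_expR ler_pM2l// /L le_max lexx.
  by [].
- by apply: EQ_leD => //; split; rewrite ?EZ.
Qed.

Lemma E_log_part_fun : exists2 C, 0 < C &
  forall n v, E_le (fun y => `|ln (Z n v y)|) C.
Proof.
have [s [C [s_gt0 C0 HC]]] := E_log_part_fun_exp.
exists (s^-1 * C); first by rewrite mulr_gt0// invr_gt0.
move=> n v; apply: EQ_le_mono (EQ_leZ _ (HC n v)).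
- by apply: depends_on_normr; exact: (depends_on_meas (@depends_on_ln_part_fun R d b f n v)).
- by move=> y; rewrite normr_ge0 abs_le_expR.
- by rewrite invr_ge0 ltW.
Qed.

(** The Markov property of the Gibbs measure: a first letter of law [p i], then an independent
    choice from the Gibbs measure of that child. *)
Lemma gibbs_cons n v i w y : gibbs b f n.+1 v (i :: w) y =
  (a v i y * Z n (rcons v i) y / Z n.+1 v y) * gibbs b f n (rcons v i) w y.
Proof.
rewrite /gibbs /= -/(part_fun b f n.+1 v y).
by field; rewrite !gt_eqF ?Z_gt0.
Qed.

(** Two Gibbs words can already differ in their first letter, since two of its atoms have integrable
    logarithms. An empty block would collide with probability 1, hence the length [n.+1]. *)
Lemma E_gibbs_collision : exists2 rho, 0 < rho < 1 & forall n v,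
  E_le (fun y => word_sum n.+1 (fun w => gibbs b f n.+1 v w y ^+ 2)) rho.
Proof.
have [Cl Cl0 HCl] := E_log_part_fun.
pose BA := s0^-1 * B0.
have BA0 : 0 <= BA by rewrite mulr_ge0// invr_ge0 ltW.
have HA v i : E_le (A v i) BA.
  apply: EQ_le_mono (EQ_leZ _ (edge_exp v i)).
  - exact: (depends_on_meas (@A_depends v i)).
  - by move=> y; rewrite normr_ge0 abs_le_expR.
  - by rewrite invr_ge0 ltW.
(* A bound for the mean of [U] below: two edges, two children, and the parent twice since it
   normalises both [p i0] and [p i1]. *)
pose C := BA + BA + (Cl + Cl + 2 * Cl).
have C0 : 0 < C by rewrite /C; lra.
exists (1 - expR (- C)).
  by rewrite subr_gt0 ltrBlDr ltrDl expR_gt0 expR_lt1 oppr_lt0 C0.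
move=> n v.
pose U y := A v i0 y + A v i1 y + (`|ln (Z n (rcons v i0) y)| +
   `|ln (Z n (rcons v i1) y)| + 2 * `|ln (Z n.+1 v y)|).
have EU : E_le U C.
  apply: (EQ_leD (EQ_leD (HA _ _) (HA _ _)) (EQ_leD (EQ_leD (HCl _ _) (HCl _ _)) _)).
  exact: EQ_leZ.
have e0 := expR_gt0 (- C).
(* [sum_i p_i^2 <= 1 - p_0 p_1] and [p_0 p_1 >= exp (- U)], which is bounded below by the tangent
   of the exponential at [- C <= - E U]. *)
apply: (@EQ_le_mono _ _ _ _ (fun y => (1 - expR (- C) * (1 + C)) + expR (- C) * U y)); last first.
- apply: EQ_le_trans (EQ_leD (EQ_le_cst _ _) (EQ_leZ (ltW e0) EU)) _.
  by rewrite mulrDr mulr1; lra.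
- move=> y; apply/andP; split; first by apply: word_sum_ge0 => w; exact: sqr_ge0.
  pose p i := a v i y * Z n (rcons v i) y / Z n.+1 v y.
  have p_gt0 i : 0 < p i by rewrite divr_gt0// mulr_gt0// edge_weight_gt0.
  have sp : \sum_i p i = 1.
    by rewrite /p -mulr_suml divff// gt_eqF// (Z_gt0 n.+1 v y).
  (* Once the first letters agree, the collision probability of the remaining letters is simply
     bounded by 1. *)
  apply: (@le_trans _ _ (\sum_i p i ^+ 2)).
    rewrite word_sumS; apply: ler_sum => i _.
    rewrite (_ : word_sum n _ =
      p i ^+ 2 * word_sum n (fun w => gibbs b f n (rcons v i) w y ^+ 2)); last first.
      by rewrite -word_sumZ; apply: eq_word_sum => w _; rewrite gibbs_cons exprMn.
    rewrite ler_piMr ?sqr_ge0//.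
    rewrite -(sum_gibbs b f d_gt0 n (rcons v i) y); apply: ler_word_sum => w sw.
    rewrite expr2 ler_piMl ?gibbs_ge0//.
    rewrite -(sum_gibbs b f d_gt0 n (rcons v i) y).
    by apply: (word_le_sum (F := fun w => gibbs b f n (rcons v i) w y)) sw => w'; exact: gibbs_ge0.
  have p1 i : p i <= 1.
    by rewrite -sp (bigD1 i)//= lerDl sumr_ge0// => j _; exact: ltW.
  have p01 : p i0 + p i1 <= 1.
    rewrite -sp (bigD1 i0)//= lerD2l (bigD1 i1)//= lerDl sumr_ge0// => j _; exact: ltW.
  have pp : \sum_i p i ^+ 2 <= 1 - p i0 * p i1.
    have : p i0 * p i1 <= \sum_i p i * (1 - p i).
      rewrite (bigD1 i0)//=; apply: (@le_trans _ _ (p i0 * (1 - p i0))).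
        by rewrite ler_pM2l//; lra.
      rewrite lerDl sumr_ge0// => j _; rewrite mulr_ge0 ?(ltW (p_gt0 _))//.
      by rewrite subr_ge0.
    under eq_bigr do rewrite mulrBr mulr1 -expr2.
    by rewrite sumrB sp; lra.
  apply: le_trans pp _.
  have : expR (- U y) <= p i0 * p i1.
    have pp0 : 0 < p i0 * p i1 by rewrite mulr_gt0 ?p_gt0.
    rewrite -(lnK pp0) ler_expR lnM ?posrE ?p_gt0//.
    have lnp i : - (A v i y + `|ln (Z n (rcons v i) y)| + `|ln (Z n.+1 v y)|) <= ln (p i).
      rewrite /p ln_div ?posrE ?mulr_gt0 ?edge_weight_gt0 ?Z_gt0//.
      rewrite lnM ?posrE ?edge_weight_gt0// expRK.
      have h1 := ler_norm (- (b * y v i - f)); rewrite normrN in h1.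
      have h2 := ler_norm (- ln (Z n (rcons v i) y)); rewrite normrN in h2.
      have h3 := ler_norm (ln (Z n.+1 v y)).
      rewrite /A; lra.
    have := lnp i0; have := lnp i1; rewrite /U; lra.
  have : expR (- C) * (1 + (C - U y)) <= expR (- U y).
    rewrite (_ : expR (- U y) = expR (- C) * expR (C - U y)).
      by rewrite ler_pM2l// expR_ge1Dx.
    by rewrite -expRD; congr expR; ring.
  by rewrite mulrDr mulr1 mulrBr; lra.
- apply: depends_on_sum => w;
  rewrite (_ : (fun y => _) = fun y => gibbs b f n.+1 v w y * gibbs b f n.+1 v w y).
    apply: depends_onM; apply: (@depends_on_meas _ _ (subtree v n.+1));
      apply: depends_on_gibbs => //; exact: size_tuple.
  by apply/funext => y; rewrite expr2.
Qed.

End LogMoments.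

(** * Fluctuations of the sampled averages *)

Section Fluctuations.
Context {R : realType} {d : nat}.
Variable Q : probability (@sigma_env R d predT) R.
Hypothesis iidQ : iid_law Q.
Local Notation V := (seq 'I_d).
Local Notation env := (@env R d).
Hypothesis d_gt0 : (0 < d)%N.
Variables (b f : R).
Local Notation Z := (part_fun b f).
Local Notation E := (EQ Q).
Local Notation E_le := (EQ_le Q).
Local Notation L1 := (L1 Q).
Implicit Types (v w u : V) (y : env) (n : nat).

Variables (s Cs rho : R).
Hypotheses (s_gt0 : 0 < s) (Cs_gt0 : 0 < Cs).
Hypothesis exp_log : forall n v, E_le (fun y => expR (s * `|ln (Z n v y)|)) Cs.
Hypothesis rho01 : 0 < rho < 1.
Hypothesis collision : forall n v,
  E_le (fun y => word_sum n.+1 (fun w => gibbs b f n.+1 v w y ^+ 2)) rho.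

Let collision_gt0 n v : (0 < n)%N ->
  E_le (fun y => word_sum n (fun w => gibbs b f n v w y ^+ 2)) rho.
Proof. by case: n => // n _; exact: collision. Qed.

Let Z_gt0 n v y : 0 < Z n v y. Proof. exact: part_fun_gt0. Qed.

Lemma L1_lnZ n v : L1 (fun y => ln (Z n v y)).
Proof.
have [ie _] := exp_log n v.
apply: (L1_le _ _ (L1Z s^-1 ie)); last by move=> y; exact: abs_le_expR.
exact: (depends_on_meas (@depends_on_ln_part_fun R d b f n v)).
Qed.

Let c n := E (fun y => ln (Z n [::] y)).

Lemma E_lnZ n v : E (fun y => ln (Z n v y)) = c n.
Proof.
have [_ H] := EQ_shift iidQ v (L1_lnZ n [::]).
rewrite /c -[RHS]H; congr EQ; apply/funext => y /=.
by rewrite -part_fun_shift cats0.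
Qed.

Lemma abs_mean_le n : `|c n| <= s^-1 * Cs.
Proof.
apply: le_trans (le_normr_EQ (L1_lnZ n [::])) _.
have := @EQ_leZ _ _ _ s^-1 _ _ _ (exp_log n [::]).
move=> /(_ _)[|i]; first by rewrite invr_ge0 ltW.
apply: le_trans; apply: EQ_mono => //; first exact: (integrable_norm (L1_lnZ n [::])).
by move=> y; exact: abs_le_expR.
Qed.

Let xi n u y := ln (Z n u y) - c n.

Let xi_depends n u : depends_on (subtree u n) (xi n u).
Proof. by apply: depends_onB; [exact: depends_on_ln_part_fun|exact: depends_on_cst]. Qed.

(** Centring costs the factor [expR Cs], because [s * |c n| <= Cs]. *)
Let C3 := expR Cs * Cs.
Let C3_gt0 : 0 < C3. Proof. by rewrite mulr_gt0// expR_gt0. Qed.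

Let xi_exp n u : E_le (fun y => expR (s * `|xi n u y|)) C3.
Proof.
apply: EQ_le_mono (EQ_leZ (expR_ge0 Cs) (exp_log n u)).
- apply: depends_on_expR; apply: depends_onM; first exact: depends_on_cst.
  by apply: depends_on_normr; exact: (depends_on_meas (@xi_depends n u)).
- move=> y; rewrite expR_ge0 -expRD ler_expR /=.
  have sc : s * `|c n| <= Cs by rewrite -ler_pdivlMl// abs_mean_le.
  have h : `|xi n u y| <= `|ln (Z n u y)| + `|c n| by exact: ler_normB.
  by rewrite addrC; apply: le_trans (lerD (lexx _) sc); rewrite -mulrDr ler_pM2l.
Qed.

Let L1_xi n u : L1 (xi n u).
Proof. by apply: L1B; [exact: L1_lnZ|exact: L1_cst]. Qed.

Let E_xi n u : E (xi n u) = 0.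
Proof. by rewrite EQB ?E_lnZ ?EQ_cst ?subrr//; [exact: L1_lnZ|exact: L1_cst]. Qed.

Let xi_sqr : exists2 C, 0 < C & forall n u, E_le (fun y => xi n u y * xi n u y) C.
Proof.
have [C C0 HC] := powR_abs_le_expR s_gt0 (ler0n R 2).
exists (C * C3); first exact: mulr_gt0.
move=> n u; apply: EQ_le_mono (EQ_leZ (ltW C0) (xi_exp n u)).
  have mx := depends_on_meas (@xi_depends n u); exact: depends_onM.
move=> y; rewrite -expr2 sqr_ge0 /=.
by have := HC (xi n u y); rewrite powR_mulrn// real_normK ?num_real.
Qed.

Section FixedScale.
Variable M : nat.
Hypothesis M_gt0 : (0 < M)%N.
Local Notation ren := (renorm b f (fun=> M) M).

Definition shallow k : pred V := [pred u | (size u < k)%N].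

(** The first [K] blocks read only vertices of depth below [K * M], whereas the partition function
    at [u] reads vertices from that depth on; this is the independence behind all moments of
    [fluct]. *)
Lemma renorm_depends K u : size u = (K * M)%N ->
  depends_on (shallow (K * M)) (ren K u).
Proof.
move=> su; apply: depends_on_prod => -[J JK] /=.
have JM : (J.+1 * M <= size u)%N by rewrite su leq_mul2r JK orbT.
have JM' : (J * M <= size u)%N by apply: leq_trans JM; rewrite leq_mul2r leqnSn orbT.
apply: (@depends_on_sub _ _ (subtree (take (J * M) u) M)).
  move=> w /subtree_size; rewrite !inE size_takel// => h.
  by apply: leq_trans h _; rewrite -mulSnr leq_mul2r JK orbT.
apply: depends_on_gibbs => //; rewrite size_takel// size_drop.
by rewrite leq_subRL// -mulSnr.
Qed.

Lemma sum_renorm K y : word_sum (K * M) (fun u => ren K u y) = 1.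
Proof.
elim: K => [|K IH]; first by rewrite mul0n word_sum0 /renorm big_ord0.
have := @sum_renormS _ _ b f d_gt0 (fun=> M) M K (fun=> 1) y (fun _ _ => leqnn M).
rewrite mulSnr => H; rewrite -[RHS]IH.
transitivity (word_sum (K * M + M) (fun v => ren K.+1 v y * 1)).
  by apply: eq_word_sum => v _; rewrite mulr1.
by rewrite H; apply: eq_word_sum => v _; rewrite mulr1.
Qed.

Lemma renorm_le1 K u y : size u = (K * M)%N -> ren K u y <= 1.
Proof.
move=> su; rewrite -(sum_renorm K y).
by apply: (word_le_sum (F := fun u => ren K u y)) su => w; exact: renorm_ge0.
Qed.

Lemma renorm_meas K u : size u = (K * M)%N -> depends_on predT (ren K u).
Proof. by move=> su; exact: (depends_on_meas (renorm_depends su)). Qed.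

Lemma L1_renorm K u : size u = (K * M)%N -> L1 (ren K u).
Proof.
move=> su; apply: (L1_le (renorm_meas su) _ (L1_cst Q 1)) => y.
by rewrite ger0_norm ?renorm_ge0// renorm_le1.
Qed.

Lemma L1_renormM K u w : size u = (K * M)%N -> size w = (K * M)%N ->
  L1 (fun y => ren K u y * ren K w y).
Proof.
move=> su sw; apply: (L1_le _ _ (L1_cst Q 1)).
  by apply: depends_onM; exact: renorm_meas.
move=> y; rewrite ger0_norm ?mulr_ge0 ?renorm_ge0//.
by rewrite mulr_ile1 ?renorm_ge0 ?renorm_le1.
Qed.

Lemma shallow_disjoint k u n w : size u = k -> shallow k w -> subtree u n w -> False.
Proof.
by move=> su wk /subtree_prefix /size_prefix; rewrite su leqNgt => /negP; apply.
Qed.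

(** Squared weights are multiplicative over blocks, and the collision probability of the next block
    is independent of the weight of its starting point: each block contributes one factor [rho]. *)
Lemma E_sum_renorm_sqr K :
  E_le (fun y => word_sum (K * M) (fun u => ren K u y * ren K u y)) (rho ^+ K).
Proof.
have [/ltW rho0 _] := andP rho01.
elim: K => [|K IH].
  rewrite (_ : (fun y => _) = fun=> 1); first by rewrite expr0; exact: EQ_le_cst.
  by apply/funext => y; rewrite mul0n word_sum0 /renorm big_ord0 mulr1.
rewrite (_ : (fun y => _) = fun y => word_sum (K * M) (fun u =>
    (ren K u y * ren K u y) * word_sum M (fun w => gibbs b f M u w y ^+ 2))); last first.
  apply/funext => y; rewrite mulSnr word_sum_cat; apply: eq_word_sum => u su.
  rewrite -word_sumZ; apply: eq_word_sum => w sw.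
  by rewrite renorm_cat// expr2 mulrACA.
apply: (@EQ_le_trans _ _ _ _ (\sum_(u : (K * M).-tuple 'I_d)
   E (fun y => ren K u y * ren K u y) * rho)).
  apply: EQ_le_sum => u; have su := size_tuple u.
  apply: (EQ_leM iidQ (A := shallow (K * M)) (B := subtree u M)
    (F := fun y => ren K u y * ren K u y)
    (G := fun y => word_sum M (fun w => gibbs b f M u w y ^+ 2))).
  - by move=> w; exact: shallow_disjoint.
  - by apply: depends_onM; exact: renorm_depends.
  - apply: depends_on_sum => w.
    rewrite (_ : (fun y => _) = fun y => gibbs b f M u w y * gibbs b f M u w y).
      by apply: depends_onM; apply: depends_on_gibbs => //; exact: size_tuple.
    by apply/funext => y; rewrite expr2.
  - by move=> y; rewrite mulr_ge0 ?renorm_ge0.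
  - by move=> y; apply: word_sum_ge0 => w; exact: sqr_ge0.
  - by split; [exact: L1_renormM|exact: lexx].
  - exact: collision_gt0.
rewrite -mulr_suml exprSr ler_wpM2r//.
have [_] := IH; apply: le_trans; rewrite le_eqVlt; apply/orP; left; apply/eqP/esym.
rewrite /word_sum EQ_sum// => u; apply: L1_renormM; exact: size_tuple.
Qed.

Definition fluct n K y : R := word_sum (K * M) (fun u => ren K u y * ln (Z n u y)) - c n.

(** The weights sum to 1, so the centring moves inside the average. *)
Lemma fluctE n K y : fluct n K y = word_sum (K * M) (fun u => ren K u y * xi n u y).
Proof.
rewrite /fluct /xi -[c n in LHS]mul1r -(sum_renorm K y) /word_sum mulr_suml -sumrB.
by apply: eq_bigr => u _; rewrite mulrBr.
Qed.

Lemma fluct_meas n K : depends_on predT (fluct n K).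
Proof.
apply: depends_onB; last exact: depends_on_cst.
apply: depends_on_sum => u; apply: depends_onM.
  by apply: renorm_meas; exact: size_tuple.
exact: (depends_on_meas (@depends_on_ln_part_fun R d b f n u)).
Qed.

Lemma E_fluct n K : L1 (fluct n K) /\ E (fluct n K) = 0.
Proof.
have -> : fluct n K = fun y => \sum_(u : (K * M).-tuple 'I_d) ren K u y * xi n u y.
  by apply/funext => y; rewrite fluctE.
have H (u : (K * M).-tuple 'I_d) :
    L1 (fun y => ren K u y * xi n u y) /\ E (fun y => ren K u y * xi n u y) = 0.
  have su := size_tuple u.
  have [i1 E1] := @EQ_indep _ _ _ iidQ (shallow (K * M)) (subtree u n) (ren K u) (xi n u)
    (fun w => @shallow_disjoint (K * M) u n w su) (renorm_depends su) (@xi_depends n u)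
    (L1_renorm su) (L1_xi n u).
  by split => //; rewrite E1 E_xi mulr0.
split; first by apply: L1_sum => u; case: (H u).
rewrite EQ_sum; last by move=> u; case: (H u).
by rewrite big1// => u _; case: (H u).
Qed.

(** For distinct [u] and [w] of the same length the centred logarithms are independent of each other
    and of the weights, so cross terms vanish; the diagonal is the sum of squared weights. *)
Lemma E_fluct_sqr C n K : (forall u, E_le (fun y => xi n u y * xi n u y) C) ->
  E_le (fun y => fluct n K y * fluct n K y) (C * rho ^+ K).
Proof.
move=> HC.
have C0 : 0 <= C.
  have [_] := HC [::]; apply: le_trans; apply: EQ_ge0 => y; rewrite -expr2; exact: sqr_ge0.
pose G (u w : (K * M).-tuple 'I_d) y := (ren K u y * ren K w y) * (xi n u y * xi n w y).
have -> : (fun y => fluct n K y * fluct n K y) = fun y => \sum_u \sum_w G u w y.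
  apply/funext => y; rewrite !fluctE /word_sum mulr_suml; apply: eq_bigr => u _.
  by rewrite mulr_sumr; apply: eq_bigr => w _; rewrite mulrACA.
have GE (u w : (K * M).-tuple 'I_d) : E_le (G u w)
    (if u == w then C * E (fun y => ren K u y * ren K u y) else 0).
  have su := size_tuple u; have sw := size_tuple w.
  have [<-|uw] := eqVneq u w.
    rewrite mulrC.
    apply: (EQ_leM iidQ (A := shallow (K * M)) (B := subtree u n)
      (F := fun y => ren K u y * ren K u y) (G := fun y => xi n u y * xi n u y)).
    - by move=> x; exact: shallow_disjoint.
    - by apply: depends_onM; exact: renorm_depends.
    - by apply: depends_onM; exact: xi_depends.
    - by move=> y; rewrite mulr_ge0 ?renorm_ge0.
    - by move=> y; rewrite -expr2; exact: sqr_ge0.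
    - by split; [exact: L1_renormM|exact: lexx].
    - exact: HC.
  have uw' : tval u != tval w by apply: contra uw => /eqP/val_inj ->.
  have [i1 E1] := @EQ_indep _ _ _ iidQ (subtree u n) (subtree w n) (xi n u) (xi n w)
    (fun x xu xw => prefix_disjoint (etrans su (esym sw)) uw'
      (subtree_prefix xu) (subtree_prefix xw))
    (@xi_depends n u) (@xi_depends n w) (L1_xi n u) (L1_xi n w).
  pose B := [pred x | subtree u n x || subtree w n x].
  have dB : depends_on B (fun y => xi n u y * xi n w y).
    apply: depends_onM.
      by apply: depends_on_sub (@xi_depends n u) => x; rewrite !inE => xu; apply/orP; left.
    by apply: depends_on_sub (@xi_depends n w) => x; rewrite !inE => xu; apply/orP; right.
  have AB x : shallow (K * M) x -> B x -> False.
    by move=> xs /orP[]; [exact: shallow_disjoint su xs|exact: shallow_disjoint sw xs].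
  have [i2 E2] := @EQ_indep _ _ _ iidQ (shallow (K * M)) B
    (fun y => ren K u y * ren K w y) (fun y => xi n u y * xi n w y) AB
    (depends_onM (renorm_depends su) (renorm_depends sw)) dB (L1_renormM su sw) i1.
  by split; [exact: i2|rewrite E2 E1 E_xi mul0r mulr0].
apply: (@EQ_le_trans _ _ _ _ (\sum_(u : (K * M).-tuple 'I_d) \sum_(w : (K * M).-tuple 'I_d)
   (if u == w then C * E (fun y => ren K u y * ren K u y) else 0))).
  by apply: EQ_le_sum => u; apply: EQ_le_sum => w; exact: GE.
rewrite (_ : \sum_u _ = C * E (fun y => word_sum (K * M) (fun u => ren K u y * ren K u y))).
  by apply: ler_wpM2l => //; have [] := E_sum_renorm_sqr K.
rewrite /word_sum EQ_sum; last by move=> u; apply: L1_renormM; exact: size_tuple.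
rewrite mulr_sumr; apply: eq_bigr => u _.
by rewrite -big_mkcond/= (big_pred1 u)// => w; rewrite eq_sym.
Qed.

(** Jensen's inequality for the random weights, followed by their independence from the [xi], makes
    the bound uniform in [K]. *)
Lemma E_fluct_exp n K : E_le (fun y => expR (s * `|fluct n K y|)) C3.
Proof.
apply: (@EQ_le_mono _ _ _ _ (fun y => \sum_(u : (K * M).-tuple 'I_d)
    ren K u y * expR (s * `|xi n u y|))).
- apply: depends_on_expR; apply: depends_onM; first exact: depends_on_cst.
  by apply: depends_on_normr; exact: fluct_meas.
- move=> y; rewrite expR_ge0 /=.
  have := @expR_weighted_le R _ (fun u : (K * M).-tuple 'I_d => ren K u y)
    (fun u : (K * M).-tuple 'I_d => s * `|xi n u y|)
    (fun u : (K * M).-tuple 'I_d => renorm_ge0 b f (fun=> M) M K u y) (sum_renorm K y).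
  apply: le_trans; rewrite ler_expR.
  under eq_bigr do rewrite mulrCA.
  rewrite -mulr_sumr ler_pM2l// fluctE.
  apply: le_trans (ler_norm_sum _ _ _) _; apply: ler_sum => u _.
  by rewrite normrM ger0_norm ?renorm_ge0.
- apply: (@EQ_le_trans _ _ _ _ (\sum_(u : (K * M).-tuple 'I_d) E (ren K u) * C3)).
    apply: EQ_le_sum => u; have su := size_tuple u.
    apply: (EQ_leM iidQ (A := shallow (K * M)) (B := subtree u n)
      (F := ren K u) (G := fun y => expR (s * `|xi n u y|))).
    + by move=> x; exact: shallow_disjoint.
    + exact: renorm_depends.
    + apply: depends_on_expR; apply: depends_onM; first exact: depends_on_cst.
      by apply: depends_on_normr; exact: xi_depends.
    + by move=> y; exact: renorm_ge0.
    + by move=> y; exact: expR_ge0.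
    + by split; [exact: L1_renorm|exact: lexx].
    + exact: xi_exp.
  rewrite -mulr_suml -EQ_sum; last by move=> u; apply: L1_renorm; exact: size_tuple.
  rewrite (_ : (fun y => _) = fun=> 1) ?EQ_cst ?mul1r//.
  by apply/funext => y; exact: sum_renorm.
Qed.

End FixedScale.

(** Moments are interpolated between a variance of order [rho ^+ K] and a bounded moment; their
    geometric mean decays like [tau ^+ K]. *)
Let tau := Num.sqrt rho.

Lemma E_fluct_pow p : 1 <= p -> exists2 D, 0 < D & forall M n K, (0 < M)%N ->
  E_le (fun y => `|fluct M n K y| `^ p) (D * tau ^+ K).
Proof.
move=> p1; have [rho0 rho1] := andP rho01.
have tau0 : 0 < tau by rewrite sqrtr_gt0.
have tauE : tau * tau = rho by rewrite -expr2 sqr_sqrtr// ltW.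
have [C C0 HC] := xi_sqr.
have q0 : 0 <= (p - 1) * 2 by rewrite mulr_ge0// subr_ge0.
have [C4 C40 HC4] := powR_abs_le_expR s_gt0 q0.
have D0 : 0 < C + C4 * C3 by rewrite addr_gt0// mulr_gt0.
exists ((C + C4 * C3) / 2); first by rewrite divr_gt0.
move=> M n K M0; have tK : 0 < tau ^+ K by rewrite exprn_gt0.
(* [|F|^p = |F| |F|^(p-1)] and AM-GM with weight [t = tau^K], as [E F^2] is of order [t^2]. *)
pose t := tau ^+ K.
have t0 : 0 < t by exact: tK.
pose F := fluct M n K.
apply: (@EQ_le_mono _ _ _ _ (fun y => (2 * t)^-1 * (F y * F y) +
    (t / 2 * C4) * expR (s * `|F y|))).
- by apply: depends_on_powR; apply: depends_on_normr; exact: fluct_meas.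
- move=> y; rewrite powR_ge0 /= -/(F y); set u := `|F y|.
  have u0 : 0 <= u by exact: normr_ge0.
  set v := u `^ (p - 1).
  have -> : u `^ p = u * v.
    rewrite -[in LHS](subrK 1 p) addrC powRD ?powRr1// subrKC.
    by rewrite gt_eqF// (lt_le_trans _ p1).
  have vv : v ^+ 2 <= C4 * expR (s * u).
    by rewrite /v -powR_mulrn ?powR_ge0// -powRrM; exact: HC4.
  have -> : F y * F y = u ^+ 2 by rewrite -expr2 real_normK ?num_real.
  pose w := u / t.
  have uE : u = t * w by rewrite /w mulrCA divff ?mulr1// gt_eqF.
  have -> : (2 * t)^-1 * u ^+ 2 = t / 2 * w ^+ 2.
    by rewrite uE; field; rewrite gt_eqF.
  have sq : 0 <= t * (w - v) ^+ 2 by rewrite mulr_ge0 ?sqr_ge0// ltW.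
  have tv : t * v ^+ 2 <= t * (C4 * expR (s * u)) by rewrite ler_pM2l.
  rewrite [in leLHS]uE.
  have -> : t / 2 * C4 * expR (s * u) = t * (C4 * expR (s * u)) / 2 by ring.
  have e1 : t * (w - v) ^+ 2 = t * w ^+ 2 + t * v ^+ 2 - 2 * (t * w * v) by ring.
  have -> : t / 2 * w ^+ 2 = t * w ^+ 2 / 2 by ring.
  by move: sq; rewrite e1; lra.
- apply: EQ_le_trans.
    apply: EQ_leD; apply: EQ_leZ.
    + by rewrite invr_ge0 mulr_ge0// ltW.
    + exact: (E_fluct_sqr M0 K (HC n)).
    + by rewrite mulr_ge0 ?(ltW C40)// divr_ge0// ltW.
    + exact: E_fluct_exp.
  rewrite -tauE exprMn -/t.
  have -> : (2 * t)^-1 * (C * (t * t)) + t / 2 * C4 * C3 = (C + C4 * C3) / 2 * t.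
    by field; rewrite gt_eqF.
  exact: lexx.
Qed.

Lemma E_le_Lnorm p c0 (F : env -> R) : 1 <= p ->
  E_le (fun y => `|F y| `^ p) c0 ->
  (Lnorm Q p%:E (fun y => (F y)%:E) <= (c0 `^ p^-1)%:E)%E.
Proof.
move=> p1 [iF Fc]; rewrite unlock.
have -> : (\int[Q]_y (`|(F y)%:E| `^ p) = (E (fun y => `|F y| `^ p))%:E)%E.
  by rewrite -integral_EQ//; apply: eq_integral => y _; rewrite abse_EFin poweR_EFin.
rewrite poweR_EFin lee_fin; have E0 : 0 <= E (fun y => `|F y| `^ p).
  by apply: EQ_ge0 => y; exact: powR_ge0.
apply: ge0_ler_powR => //; rewrite ?nnegrE ?invr_ge0 ?(le_trans _ p1)//.
exact: le_trans Fc.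
Qed.

Let meas_Q (F : env -> R) : depends_on predT F ->
  measurable_fun setT (F : @sigma_env R d predT -> R).
Proof. by case. Qed.

Lemma Lnorm_leD p (F G : env -> R) c1 c2 : 1 <= p ->
  depends_on predT F -> depends_on predT G ->
  (Lnorm Q p%:E (fun y => (F y)%:E) <= c1%:E)%E ->
  (Lnorm Q p%:E (fun y => (G y)%:E) <= c2%:E)%E ->
  (Lnorm Q p%:E (fun y => (F y + G y)%:E) <= (c1 + c2)%:E)%E.
Proof.
move=> p1 mF mG Fc Gc.
have := minkowski_EFin Q (meas_Q mF) (meas_Q mG) p1.
by move=> /le_trans; apply; rewrite EFinD; exact: leeD.
Qed.

Lemma Lnorm_leN p (F : env -> R) c1 :
  (Lnorm Q p%:E (fun y => (F y)%:E) <= c1%:E)%E ->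
  (Lnorm Q p%:E (fun y => (- F y)%:E) <= c1%:E)%E.
Proof. by move=> Fc; have := oppe_Lnorm Q (fun y => (F y)%:E) p%:E => /= ->. Qed.

Lemma Lnorm_le_cst p (x : R) : 1 <= p ->
  (Lnorm Q p%:E (fun=> x%:E) <= `|x|%:E)%E.
Proof.
move=> p1; have := @E_le_Lnorm p (`|x| `^ p) (fun=> x) p1 (EQ_le_cst _ _).
by rewrite -powRrM mulfV ?powRr1// gt_eqF// (lt_le_trans _ p1).
Qed.

Lemma Lnorm_le_sum p k (F : nat -> env -> R) (C : nat -> R) : 1 <= p ->
  (forall K, depends_on predT (F K)) ->
  (forall K, (Lnorm Q p%:E (fun y => (F K y)%:E) <= (C K)%:E)%E) ->
  (Lnorm Q p%:E (fun y => (\sum_(K < k) F K y)%:E) <= (\sum_(K < k) C K)%:E)%E.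
Proof.
move=> p1 mF HC; elim: k => [|k IH].
  rewrite (_ : (fun y => _) = fun=> 0%:E).
    by rewrite big_ord0; have := Lnorm_le_cst 0 p1; rewrite normr0.
  by apply/funext => y; rewrite big_ord0.
rewrite big_ord_recr /= (_ : (fun y => _) = fun y => (\sum_(K < k) F K y + F k y)%:E).
  by apply: Lnorm_leD => //; exact: depends_on_sum.
by apply/funext => y; rewrite big_ord_recr.
Qed.

(** * Mean and fluctuation of the divergence *)

Section KullbackLeibler.
Variables (N M : nat).
Let m K := minn M (N - K * M).

Definition kl_mean : R := c N - \sum_(K < (N %/ M).+1) c (m K).

(** At [K = 0] the only word is the root, so [fluct M N 0] is the centred logarithm of the full
    partition function. *)
Definition kl_fluct y : R := fluct M N 0 y - \sum_(K < (N %/ M).+1) fluct M (m K) K y.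

Lemma klE y : kl b f N M y = kl_fluct y + kl_mean.
Proof.
rewrite /kl /kl_fluct /kl_mean /fluct sumrB mul0n word_sum0 /renorm big_ord0 mul1r.
ring.
Qed.

Lemma kl_fluct_meas : depends_on predT kl_fluct.
Proof.
apply: depends_onB; first exact: fluct_meas.
by apply: depends_on_sum => K; exact: fluct_meas.
Qed.

Lemma E_kl : L1 (kl b f N M) /\ E (kl b f N M) = kl_mean.
Proof.
have [i0 E0] := E_fluct M N 0.
have iS : L1 (fun y => \sum_(K < (N %/ M).+1) fluct M (m K) K y).
  by apply: L1_sum => K; case: (E_fluct M (m K) K).
have ES : E (fun y => \sum_(K < (N %/ M).+1) fluct M (m K) K y) = 0.
  rewrite EQ_sum; last by move=> K; case: (E_fluct M (m K) K).
  by rewrite big1// => K _; case: (E_fluct M (m K) K).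
have -> : kl b f N M = fun y => kl_fluct y + kl_mean by apply/funext => y; exact: klE.
have iF : L1 kl_fluct by exact: L1B.
split; first by apply: L1D => //; exact: L1_cst.
by rewrite EQD ?EQ_cst//; [rewrite EQB// E0 ES subr0 add0r|exact: L1_cst].
Qed.

End KullbackLeibler.

Theorem kl_Lnorm p : 1 <= p -> exists2 C, 0 < C & forall N M,
  (0 < M)%N -> (M <= N)%N ->
  [/\ L1 (kl b f N M),
      (Lnorm Q p%:E (fun y => (kl b f N M y)%:E) <= (C * (N %/ M)%:R)%:E)%E &
      (Lnorm Q p%:E (fun y => (kl b f N M y - E (kl b f N M))%:E) <= C%:E)%E].
Proof.
move=> p1; have [D D0 HD] := E_fluct_pow p1.
have [rho0 rho1] := andP rho01.
have p0 : 0 < p by rewrite (lt_le_trans _ p1).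
have tau0 : 0 < tau by rewrite sqrtr_gt0.
have tau1 : tau < 1 by rewrite -sqrtr1 ltr_sqrt.
(* The decay rate after taking the root of order [p] of the moment bound. *)
pose q := tau `^ p^-1.
have q01 : 0 <= q < 1.
  rewrite powR_ge0 /= /q; have := @gt0_ltr_powR R p^-1 _ tau 1.
  by rewrite powR1; apply; rewrite ?nnegrE ?invr_gt0// ltW.
pose D' := D `^ p^-1.
have D'0 : 0 < D' by exact: powR_gt0.
have HF M n K : (0 < M)%N ->
    (Lnorm Q p%:E (fun y => (fluct M n K y)%:E) <= (D' * q ^+ K)%:E)%E.
  move=> M0; have := E_le_Lnorm p1 (HD M n K M0).
  rewrite powRM ?exprn_ge0 ?(ltW D0) ?(ltW tau0)//.
  rewrite (_ : (tau ^+ K) `^ p^-1 = q ^+ K)//.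
  by rewrite /q -(powR_mulrn K (ltW tau0)) -powRrM [K%:R * _]mulrC powRrM powR_mulrn ?powR_ge0.
have q1 : 0 < 1 - q by case/andP: q01; rewrite subr_gt0.
pose C1 := D' + D' * (1 - q)^-1.
have C10 : 0 < C1 by rewrite addr_gt0// divr_gt0.
pose e := s^-1 * Cs.
have e0 : 0 < e by rewrite mulr_gt0// invr_gt0.
(* [C1] bounds the fluctuation: the root term plus a geometric series. The mean has [k + 2] terms,
   each at most [e], and [k >= 1] gives [k + 2 <= 3 * k]. *)
exists (C1 + 3 * e); first by rewrite addr_gt0// mulr_gt0.
move=> N M M0 MN; set k := (N %/ M)%N.
have k1 : 1 <= k%:R :> R by rewrite ler1n divn_gt0.
have HK : (Lnorm Q p%:E (fun y => (kl_fluct N M y)%:E) <= C1%:E)%E.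
  apply: Lnorm_leD => //; first exact: fluct_meas.
  - rewrite (_ : (fun y => _) = fun y => -1 * \sum_(K < k.+1) fluct M (minn M (N - K * M)) K y).
      apply: depends_onM; first exact: depends_on_cst.
      by apply: depends_on_sum => K; exact: fluct_meas.
    by apply/funext => y; rewrite mulN1r.
  - by have := HF M N 0%N M0; rewrite expr0 mulr1.
  - apply: Lnorm_leN.
    apply: le_trans (@Lnorm_le_sum p k.+1 (fun K y => fluct M (minn M (N - K * M)) K y)
      (fun K => D' * q ^+ K) p1 _ _) _.
    + by move=> K; exact: fluct_meas.
    + by move=> K; exact: HF.
    + by rewrite lee_fin -mulr_sumr ler_pM2l// geometric_sum_le.
have [ikl Ekl] := E_kl N M.
split => //; last first.
  rewrite Ekl (_ : (fun y => _) = fun y => (kl_fluct N M y)%:E).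
    by apply: le_trans HK _; rewrite lee_fin lerDl mulr_ge0// ltW.
  by apply/funext => y; rewrite klE addrK.
rewrite (_ : (fun y => _) = fun y => (kl_fluct N M y + kl_mean N M)%:E); last first.
  by apply/funext => y; rewrite klE.
apply: le_trans (Lnorm_leD p1 (kl_fluct_meas N M) _ HK (Lnorm_le_cst _ p1)) _.
  exact: depends_on_cst.
rewrite lee_fin.
have : `|kl_mean N M| <= e + k.+1%:R * e.
  apply: le_trans (ler_normB _ _) _; apply: lerD; first exact: abs_mean_le.
  apply: le_trans (ler_norm_sum _ _ _) _.
  apply: (@le_trans _ _ (\sum_(K < k.+1) e)); last by rewrite sumr_const card_ord mulr_natl.
  by apply: ler_sum => K _; exact: abs_mean_le.
rewrite -natr1 mulrDl mul1r; nra.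
Qed.

End Fluctuations.

(** * The generating function below the critical point *)

Section OneVertex.
Context {R : realType} {d : nat}.
Variable Q : probability (@sigma_env R d predT) R.
Local Notation env := (@env R d).
Hypothesis d_ge2 : (2 <= d)%N.
Local Notation E := (EQ Q).
Local Notation E_le := (EQ_le Q).
Local Notation L1 := (L1 Q).
Implicit Types (t b e : R) (i : 'I_d).

Let d_gt0 : (0 < d)%N. Proof. exact: ltnW. Qed.
Let i0 : 'I_d := Ordinal d_gt0.

Definition exp_sum t (y : env) : R := \sum_(i < d) expR (t * y [::] i).
Definition mgf_env t : R := E (exp_sum t).

Lemma exp_depends t i : depends_on predT (fun y : env => expR (t * y [::] i)).
Proof.
apply: depends_on_expR; apply: depends_onM; first exact: depends_on_cst.
exact: depends_on_coord.
Qed.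

Lemma exp_sum_depends t : depends_on predT (exp_sum t).
Proof. by apply: depends_on_sum => i; exact: exp_depends. Qed.

Lemma exp_sum_ge t i y : expR (t * y [::] i) <= exp_sum t y.
Proof. by rewrite /exp_sum (bigD1 i)//= lerDl sumr_ge0// => j _; exact: expR_ge0. Qed.

Lemma exp_sum_gt0 t y : 0 < exp_sum t y.
Proof. exact: lt_le_trans (expR_gt0 _) (exp_sum_ge t i0 y). Qed.

Lemma L1_exp t i : L1 (exp_sum t) -> L1 (fun y => expR (t * y [::] i)).
Proof.
apply: L1_le; first exact: exp_depends.
by move=> y; rewrite ger0_norm ?expR_ge0 ?exp_sum_ge.
Qed.

Lemma EQ_gt0 (F : env -> R) : L1 F -> (forall y, 0 < F y) -> 0 < E F.
Proof.
move=> iF F0; rewrite lt_def EQ_ge0 ?andbT; last by move=> y; exact: ltW.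
apply/eqP => EF0.
have mF : measurable_fun setT (fun y : @sigma_env R d predT => (F y)%:E).
  by have [mF] := L1_meas iF; exact/measurable_EFinP.
have : (\int[Q]_y `|(F y)%:E| = 0)%E.
  under eq_integral do rewrite abse_EFin ger0_norm ?(ltW (F0 _))//.
  by rewrite integral_EQ// EF0.
move=> /(ae_eq_integral_abs Q measurableT mF) [N [mN N0 TN]].
have NT : N = setT.
  apply/seteqP; split => // y _; apply: TN => /=.
  by move=> /(_ I) [] /eqP; rewrite gt_eqF.
have : Q setT = 1%E by exact: probability_setT.
by rewrite -NT N0 => /eqP; rewrite eqe eq_sym oner_eq0.
Qed.

Lemma mgf_env_gt0 t : L1 (exp_sum t) -> 0 < mgf_env t.
Proof. by move=> iS; apply: EQ_gt0 => // y; exact: exp_sum_gt0. Qed.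

(** According to the sign of [x], [exp (t x)] is at most [exp (b x)] or at most 1. *)
Lemma L1_exp_sum_between t b : 0 <= t -> t <= b -> L1 (exp_sum b) -> L1 (exp_sum t).
Proof.
move=> t0 tb iS; apply: L1_sum => i.
apply: (L1_le _ _ (L1D (L1_cst Q 1) (L1_exp i iS))); first exact: exp_depends.
move=> y; rewrite ger0_norm ?expR_ge0//.
have [y0|y0] := leP 0 (y [::] i).
  apply: (@le_trans _ _ (expR (b * y [::] i))); last by rewrite lerDr.
  by rewrite ler_expR ler_wpM2r.
apply: (@le_trans _ _ 1); last by rewrite lerDl expR_ge0.
by rewrite -expR0 ler_expR mulr_ge0_le0// ltW.
Qed.

Lemma mgf_env_derivable b e : 0 < e ->
  (forall t, `|t - b| < e -> L1 (exp_sum t)) ->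
  let S' (y : env) := \sum_(i < d) y [::] i * expR (b * y [::] i) in
  [/\ L1 S', derivable mgf_env b 1 & derive1 mgf_env b = E S'].
Proof.
move=> e0 De S'.
(* The parameter will stay within [e / 2] of [b]; the remaining margin [e / 4] absorbs the factor
   [|x|] produced by differentiation, as [|x| <= (4 / e) exp (e |x| / 4)]. *)
pose bp := b + 3 * e / 4; pose bm := b - 3 * e / 4.
have ip : L1 (exp_sum bp).
  by apply: De; rewrite (_ : bp - b = 3 * e / 4) ?ger0_norm; [lra|lra|rewrite /bp; ring].
have im : L1 (exp_sum bm).
  apply: De; rewrite (_ : bm - b = - (3 * e / 4)) ?normrN ?ger0_norm; [lra|lra|].
  by rewrite /bm; ring.
pose G (y : env) := 4 / e * (exp_sum bp y + exp_sum bm y).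
have iG : L1 G by apply: L1Z; exact: L1D.
have G0 y : 0 <= G y.
  by rewrite mulr_ge0 ?divr_ge0 ?addr_ge0// ltW// exp_sum_gt0.
pose f t (y : env) := exp_sum t y.
have df t y : is_derive t 1 (f^~ y) (\sum_(i < d) y [::] i * expR (t * y [::] i)).
  have -> : f^~ y = \sum_(i < d) (fun t => expR (t * y [::] i)).
    by apply/funext => u; rewrite /f /exp_sum fct_sumE.
  apply: is_derive_sum => i; apply: is_derive_eq.
  by rewrite /GRing.scale /=; ring.
have d1f t y : partial1of2 f t y = \sum_(i < d) y [::] i * expR (t * y [::] i).
  by rewrite /partial1of2 derive1E; apply: derive_val.
have G_ub t y : `]b - e / 2, b + e / 2[%classic t -> `|partial1of2 f t y| <= G y.
  rewrite /= in_itv /= => /andP[t1 t2]; rewrite d1f.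
  apply: le_trans (ler_norm_sum _ _ _) _.
  rewrite /G /exp_sum -big_split /= mulr_sumr; apply: ler_sum => i _.
  set x := y [::] i; rewrite normrM [`|expR _|]ger0_norm ?expR_ge0//.
  have hx : `|x| <= 4 / e * expR (e / 4 * `|x|).
    have h := expR_ge1Dx (e / 4 * `|x|).
    have e4 : 0 < 4 / e by rewrite divr_gt0.
    have := @ler_wpM2l _ _ (ltW e4) _ _ h.
    rewrite mulrDr mulr1 mulrA (_ : 4 / e * (e / 4) = 1); last by field; rewrite gt_eqF.
    by rewrite mul1r; lra.
  have hE : expR (e / 4 * `|x|) * expR (t * x) <= expR (bp * x) + expR (bm * x).
    rewrite -expRD; have [x0|x0] := leP 0 x.
      apply: (@le_trans _ _ (expR (bp * x))); last by rewrite lerDl expR_ge0.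
      by rewrite ler_expR ger0_norm// -mulrDl ler_wpM2r// /bp; lra.
    apply: (@le_trans _ _ (expR (bm * x))); last by rewrite lerDr expR_ge0.
    by rewrite ler_expR ltr0_norm// mulrN -mulNr -mulrDl ler_nM2r// /bm; lra.
  apply: (@le_trans _ _ (4 / e * expR (e / 4 * `|x|) * expR (t * x))).
    by rewrite ler_wpM2r ?expR_ge0.
  by rewrite -mulrA ler_wpM2l// divr_ge0// ltW.
have Ib : `]b - e / 2, b + e / 2[%classic b by rewrite /= in_itv /=; apply/andP; split; lra.
have fi t : `]b - e / 2, b + e / 2[%classic t -> Q.-integrable setT (EFin \o f t).
  rewrite /= in_itv /= => /andP[t1 t2]; apply: De.
  by rewrite ltr_norml; apply/andP; split; lra.
have fd t y : `]b - e / 2, b + e / 2[%classic t -> setT y -> derivable (f^~ y) t 1.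
  by move=> _ _; have [] := df t y.
have iS' : L1 S'.
  apply: (L1_le _ _ iG); last by move=> y; have := G_ub b y Ib; rewrite d1f.
  apply: depends_on_sum => i; apply: depends_onM; last exact: exp_depends.
  exact: depends_on_coord.
have H1 := @derivable_under_integral R _ (@sigma_env R d predT) Q f setT measurableT
   b _ _ Ib fi fd G G0 iG (fun t y ht _ => G_ub t y ht).
have H2 := @differentiation_under_integral R _ (@sigma_env R d predT) Q f setT measurableT
   b _ _ Ib fi fd G G0 iG (fun t y ht _ => G_ub t y ht).
split => //; rewrite [LHS]H2; congr fine; apply: eq_integral => y _.
by rewrite d1f.
Qed.

(* Tangent at [b] of the convex function [s |-> E[sum_i exp (s (b Y_i - ln mgf_env b))]]. *)
Lemma log_mgf_slope t b e : 0 < t < b -> 0 < e ->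
  (forall u, `|u - b| < e -> L1 (exp_sum u)) ->
  b * derive1 (@ln R \o mgf_env) b < ln (mgf_env b) ->
  ln (mgf_env b) < b / t * ln (mgf_env t).
Proof.
move=> /andP[t0 tb] e0 De; have b0 : 0 < b := lt_trans t0 tb.
have ib : L1 (exp_sum b) by apply: De; rewrite subrr normr0.
have it : L1 (exp_sum t) by exact: L1_exp_sum_between (ltW t0) (ltW tb) ib.
have [iS' dm mE] := mgf_env_derivable e0 De.
set S' := fun y : env => _ in iS' mE.
have mb0 := mgf_env_gt0 ib; have mt0 := mgf_env_gt0 it.
have [dln lnE] := is_derive1_ln mb0.
rewrite derive1_comp// mE derive1E lnE => slope.
set p := ln (mgf_env b) in slope *.
have pE : expR (- p) = (mgf_env b)^-1 by rewrite expRN lnK.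
pose s := t / b.
have s0 : 0 < s by rewrite divr_gt0.
have s1 : s < 1 by rewrite ltr_pdivrMr// mul1r.
have sb : s * b = t by rewrite /s divfK// gt_eqF.
have key y : expR (- p) * ((1 - (s - 1) * p) * exp_sum b y + (s - 1) * b * S' y) <=
    expR (- s * p) * exp_sum t y.
  rewrite /exp_sum /S' !mulr_sumr -big_split /= !mulr_sumr; apply: ler_sum => i _.
  set x := y [::] i.
  have h := expR_ge1Dx ((s - 1) * (b * x - p)).
  have -> : expR (- s * p) * expR (t * x) =
      expR (- p) * expR (b * x) * expR ((s - 1) * (b * x - p)).
    by rewrite -!expRD; congr expR; rewrite -sb; ring.
  have P0 : 0 <= expR (- p) * expR (b * x) by rewrite mulr_ge0 ?expR_ge0.
  apply: le_trans (ler_wpM2l P0 h).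
  by rewrite le_eqVlt; apply/orP; left; apply/eqP; ring.
have i1 := L1Z (1 - (s - 1) * p) ib; have i2 := L1Z ((s - 1) * b) iS'.
have := EQ_mono (L1Z (expR (- p)) (L1D i1 i2)) (L1Z (expR (- s * p)) it) key.
rewrite EQZ; last exact: L1D.
rewrite EQD// !EQZ// -!/(mgf_env _) pE => h.
(* The tangent has value [1 + (1 - s) * (p - b * sl)] at [s], where [sl] is the logarithmic
   derivative at [b]; the slope hypothesis makes this exceed 1. *)
have lt1 : 1 < expR (- s * p) * mgf_env t.
  apply: lt_le_trans h.
  rewrite mulrDr mulrCA mulVf ?gt_eqF// mulr1 mulrCA.
  set sl := _^-1 * E S' in slope *.
  have : 0 < (1 - s) * (p - b * sl) by rewrite mulr_gt0// subr_gt0.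
  by nra.
rewrite mulNr expRN ltr_pdivlMl ?expR_gt0// mulr1 -[ltRHS](lnK mt0) ltr_expR in lt1.
rewrite -(ltr_pM2l s0) mulrA (_ : s * (b / t) = 1) ?mul1r//.
by rewrite /s mulrA divfK ?divff ?gt_eqF.
Qed.

Section Subcritical.
Variable beta : R.
Hypotheses (beta_ge0 : 0 <= beta).
Hypothesis near0 : exists2 e, 0 < e & forall t, `|t| < e -> L1 (exp_sum t).
Hypothesis subcritical : exists b, [/\ beta < b,
  exists2 e, 0 < e & forall t, `|t - b| < e -> L1 (exp_sum t) &
  b * derive1 (@ln R \o mgf_env) b < ln (mgf_env b)].
Local Notation f := (ln (mgf_env beta)).
Local Notation a := (edge_weight beta f).

Lemma L1_exp_sum_beta : L1 (exp_sum beta).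
Proof.
have [b [bb [e e0 De] _]] := subcritical.
apply: (L1_exp_sum_between beta_ge0 (ltW bb)).
by apply: De; rewrite subrr normr0.
Qed.

Lemma edge_mean1 : (forall i, L1 (a [::] i)) /\ \sum_i E (a [::] i) = 1.
Proof.
have iS := L1_exp_sum_beta; have m0 := mgf_env_gt0 iS.
have aE i : a [::] i = fun y => expR (- f) * expR (beta * y [::] i).
  by apply/funext => y; rewrite /edge_weight -expRD addrC.
split=> [i|]; first by rewrite aE; apply: L1Z; exact: L1_exp.
under eq_bigr do rewrite aE EQZ ?L1_exp//.
rewrite -mulr_sumr -EQ_sum; last by move=> i; exact: L1_exp.
by rewrite -/(mgf_env beta) expRN lnK// mulVf// gt_eqF.
Qed.

(** At order [T = b / beta] the edge moments sum to [psi < 1], by the slope inequality, and at order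
    1 they sum to 1. Convexity of the exponential puts every order in between strictly below 1. *)
Lemma edge_moment : exists r ka, [/\ 0 < r <= 1, ka < 1 &
  (forall i, L1 (fun y => a [::] i y `^ (1 + r))) /\
  \sum_i E (fun y => a [::] i y `^ (1 + r)) <= ka].
Proof.
have aE i r y : a [::] i y `^ (1 + r) = expR ((beta * y [::] i - f) * (1 + r)).
  by rewrite expRM.
(* At 0 the order [b / beta] makes no sense, but the weights are constant equal to [1 / d], and
   [r = 1] gives the sum [1 / d]. *)
have [beta0|betaN0] := eqVneq beta 0.
  exists 1, (d%:R^-1).
  have dR : 1 < d%:R :> R by rewrite ltr1n.
  have m0 : mgf_env beta = d%:R.
    rewrite /mgf_env (_ : exp_sum beta = fun=> d%:R) ?EQ_cst//.
    apply/funext => y; rewrite /exp_sum beta0.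
    by under eq_bigr do rewrite mul0r expR0; rewrite sumr_const card_ord.
  have aE' i : (fun y => a [::] i y `^ (1 + 1)) = fun=> d%:R^-1 * d%:R^-1.
    apply/funext => y; rewrite aE beta0 mul0r sub0r mulrDr mulr1 expRD.
    by rewrite -beta0 expRN lnK ?m0// posrE; lra.
  split; [by rewrite ltr01 lexx|by rewrite invf_lt1//; lra|].
  split=> [i|]; first by rewrite aE'; exact: L1_cst.
  under eq_bigr do rewrite aE' EQ_cst.
  rewrite sumr_const card_ord -(mulr_natr (d%:R^-1 * d%:R^-1) d) -mulrA mulVf ?mulr1//.
  by rewrite gt_eqF//; lra.
have beta_gt0 : 0 < beta by rewrite lt_def betaN0.
have [b [bb [e e0 De] slope]] := subcritical.
have ib : L1 (exp_sum b) by apply: De; rewrite subrr normr0.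
have T_lt := @log_mgf_slope beta b e _ e0 De slope.
pose T := b / beta.
have T1 : 1 < T by rewrite ltr_pdivlMr// mul1r.
have T1' : 0 < T - 1 by rewrite subr_gt0.
have mb0 := mgf_env_gt0 ib.
pose psi := expR (- (T * f)) * mgf_env b.
have psi_lt1 : psi < 1.
  rewrite /psi -[mgf_env b]lnK// -expRD expR_lt1 addrC subr_lt0.
  by apply: T_lt; rewrite beta_gt0.
(* Capped at 1 because subadditivity of the power [r] is used on the partition function. *)
pose r := Num.min 1 (T - 1).
have r0 : 0 < r by rewrite lt_min ltr01.
have r1 : r <= 1 by rewrite ge_min lexx.
have rT : r <= T - 1 by rewrite ge_min lexx orbT.
pose la := r / (T - 1).
have la0 : 0 < la by rewrite divr_gt0.
have la1 : la <= 1 by rewrite ler_pdivrMr// mul1r.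
have laT : la * (T - 1) = r by rewrite divfK// gt_eqF.
have [ia Ea] := edge_mean1.
(* The chord bound: [1 + r = (1 - la) * 1 + la * T], and the second term equals [la] times the edge
   weight to the power [T]. *)
pose B i (y : env) := (1 - la) * a [::] i y + (la * expR (- (T * f))) * expR (b * y [::] i).
have iB i : L1 (B i) by apply: L1D; apply: L1Z => //; exact: L1_exp.
have aB i y : `|a [::] i y `^ (1 + r)| <= B i y.
  rewrite ger0_norm ?powR_ge0// aE /B /edge_weight.
  set x := beta * y [::] i - f.
  have -> : la * expR (- (T * f)) * expR (b * y [::] i) = la * expR (T * x).
    rewrite -mulrA -expRD /x mulrBr mulrA divfK ?gt_eqF// [in LHS]addrC.
    by [].
  have h1 : expR (x * (1 + r)) * (1 + (- (r * x))) <= expR x.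
    rewrite [leRHS](_ : _ = expR (x * (1 + r)) * expR (- (r * x))).
      by rewrite ler_pM2l ?expR_gt0// expR_ge1Dx.
    by rewrite -expRD; congr expR; ring.
  have h2 : expR (x * (1 + r)) * (1 + (T - 1 - r) * x) <= expR (T * x).
    rewrite [leRHS](_ : _ = expR (x * (1 + r)) * expR ((T - 1 - r) * x)).
      by rewrite ler_pM2l ?expR_gt0// expR_ge1Dx.
    by rewrite -expRD; congr expR; ring.
  have h1' : (1 - la) * (expR (x * (1 + r)) * (1 + (- (r * x)))) <= (1 - la) * expR x.
    by rewrite ler_wpM2l// subr_ge0.
  have h2' := ler_wpM2l (ltW la0) h2.
  apply: le_trans (lerD h1' h2').
  rewrite le_eqVlt; apply/orP; left; apply/eqP.
  have -> : (1 - la) * (expR (x * (1 + r)) * (1 + - (r * x))) +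
    la * (expR (x * (1 + r)) * (1 + (T - 1 - r) * x)) =
    expR (x * (1 + r)) * (1 + x * (la * (T - 1) - r)) by ring.
  by rewrite laT subrr mulr0 addr0 mulr1.
exists r, ((1 - la) + la * psi); split; [by rewrite r0|nra|].
have ir i : L1 (fun y => a [::] i y `^ (1 + r)).
  apply: (L1_le _ (aB i) (iB i)); apply: depends_on_powR.
  by apply: depends_on_edge_weight.
split => //; apply: (@le_trans _ _ (\sum_i E (B i))).
  apply: ler_sum => i _; apply: EQ_mono => // y.
  by apply: le_trans (aB i y); exact: ler_norm.
have EB i : E (B i) = (1 - la) * E (a [::] i) +
    (la * expR (- (T * f))) * E (fun y => expR (b * y [::] i)).
  rewrite EQD ?EQZ//; first exact: L1_exp.
    exact: L1Z.
  by apply: L1Z; exact: L1_exp.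
under eq_bigr do rewrite EB.
rewrite big_split /= -!mulr_sumr Ea mulr1 -EQ_sum; last by move=> i; exact: L1_exp.
by rewrite -/(mgf_env b) /psi mulrA.
Qed.

Lemma edge_exponential : exists s0 B0, 0 < s0 /\
  forall i, E_le (fun y => expR (s0 * `|beta * y [::] i - f|)) B0.
Proof.
have [e e0 De] := near0.
have D1 : L1 (exp_sum (e / 2)) by apply: De; rewrite ger0_norm; lra.
have D2 : L1 (exp_sum (- (e / 2))) by apply: De; rewrite normrN ger0_norm; lra.
(* Ensures [s0 * beta <= e / 2], so both signs of the displacement are covered by the generating
   function at [e / 2] and [- (e / 2)]; the shift by 1 allows [beta = 0]. *)
pose s0 := e / 2 / (beta + 1).
have beta_nonneg : 0 <= beta := beta_ge0.
have beta1 : 0 < beta + 1 by lra.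
have s0_gt0 : 0 < s0 by rewrite divr_gt0// divr_gt0.
have s0b : s0 * beta <= e / 2.
  rewrite /s0 -mulrA ler_piMr//; first by lra.
  by rewrite mulrC ler_pdivrMr// mul1r; lra.
exists s0, (expR (s0 * `|f|) * (mgf_env (e / 2) + mgf_env (- (e / 2)))); split => // i.
apply: (@EQ_le_mono _ _ _ _ (fun y => expR (s0 * `|f|) *
   (exp_sum (e / 2) y + exp_sum (- (e / 2)) y))).
- apply: depends_on_expR; apply: depends_onM; first exact: depends_on_cst.
  apply: depends_on_normr; apply: depends_onB; last exact: depends_on_cst.
  by apply: depends_onM; [exact: depends_on_cst|exact: depends_on_coord].
- move=> y; rewrite expR_ge0 /=; set x := y [::] i.
  apply: (@le_trans _ _ (expR (s0 * `|f|) * expR (e / 2 * `|x|))).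
    rewrite -expRD ler_expR [leRHS]addrC.
    apply: (@le_trans _ _ (s0 * (`|beta * x| + `|f|))).
      by rewrite ler_pM2l// ler_normB.
    rewrite mulrDr lerD2r normrM [`|beta|]ger0_norm// mulrA.
    by rewrite ler_wpM2r.
  rewrite ler_pM2l ?expR_gt0//.
  have [x0|x0] := leP 0 x.
    rewrite ger0_norm//.
    by apply: le_trans (exp_sum_ge (e / 2) i y) _; rewrite lerDl ltW ?exp_sum_gt0.
  rewrite ltr0_norm// mulrN -mulNr.
  by apply: le_trans (exp_sum_ge (- (e / 2)) i y) _; rewrite lerDr ltW ?exp_sum_gt0.
- by apply: EQ_leZ; [exact: expR_ge0|apply: EQ_leD; split].
Qed.

End Subcritical.
End OneVertex.

(** * Return to the original probability space *)

Section Transfer.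
Context {dT : measure_display} {T : measurableType dT} {R : realType}.
Variables (P : probability T R) (d : nat) (Yv : seq 'I_d -> 'I_d -> T -> R).
Hypothesis iidY : iid_family P Yv.
Local Notation X := (env_mfun iidY).
Local Notation Q := (distribution P X).

Lemma iid_law_distribution : iid_law Q.
Proof.
split=> [A B C D AB cC cD|A u C cC]; first exact: (cylinder_indep iidY AB cC cD).
exact: (cylinder_shift iidY u cC).
Qed.

Lemma Lnorm_distribution p (F : env -> R) : depends_on predT F ->
  Lnorm P p%:E (fun x => (F (X x))%:E) = Lnorm Q p%:E (fun y => (F y)%:E).
Proof.
move=> mF; rewrite unlock; congr (_ `^ _)%E.
under eq_integral do rewrite abse_EFin poweR_EFin.
under [RHS]eq_integral do rewrite abse_EFin poweR_EFin.
have mFp : measurable_fun setT (fun y : @sigma_env R d predT => (`|F y| `^ p)%:E).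
  by have [m] := depends_on_powR p (depends_on_normr mF); exact/measurable_EFinP.
have F0 (y : @sigma_env R d predT) : (0 <= (`|F y| `^ p)%:E)%E by rewrite lee_fin powR_ge0.
by rewrite (ge0_integral_distribution _ mFp F0).
Qed.

Lemma expectation_distribution (F : env -> R) : L1 Q F ->
  fine 'E_P[F \o X] = EQ Q F.
Proof.
move=> iF; have [mF] := L1_meas iF; have /integrableP[mF' Foo] := iF.
have mF1 : measurable_fun setT (fun y : @sigma_env R d predT => (F y)%:E).
  exact/measurable_EFinP.
have iFX : P.-integrable setT ((fun y : @sigma_env R d predT => (F y)%:E) \o X).
  apply/integrableP; split.
    exact: (measurableT_comp mF1 (measurable_env_of iidY (A := predT))).
  have mF2 : measurable_fun setT (fun y : @sigma_env R d predT => `|F y|%:E).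
    by have [m] := depends_on_normr (L1_meas iF); exact/measurable_EFinP.
  have F0 (y : @sigma_env R d predT) : (0 <= `|F y|%:E)%E by rewrite lee_fin.
  have := Foo; rewrite /=.
  by rewrite (ge0_integral_distribution _ mF2 F0).
by rewrite unlock /EQ (integral_distribution mF1 iFX).
Qed.

Lemma mgf_distribution t : mgf P Yv t = (\int[Q]_y (exp_sum t y)%:E)%E.
Proof.
have mS : measurable_fun setT (fun y : @sigma_env R d predT => (exp_sum t y)%:E).
  by have [m] := @exp_sum_depends R d t; exact/measurable_EFinP.
have S0 (y : @sigma_env R d predT) : (0 <= (exp_sum t y)%:E)%E.
  by rewrite lee_fin sumr_ge0// => i _; exact: expR_ge0.
by rewrite (ge0_integral_distribution _ mS S0).
Qed.

Lemma phi_distribution : phi P Yv = @ln R \o mgf_env Q.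
Proof. by apply/funext => t; rewrite /phi mgf_distribution. Qed.

Lemma Dphi_L1 t : Dphi P Yv t -> L1 Q (exp_sum t).
Proof.
rewrite /Dphi /= mgf_distribution; apply: EQ_le_lty; first exact: exp_sum_depends.
by move=> y; rewrite sumr_ge0// => i _; exact: expR_ge0.
Qed.

End Transfer.

Theorem mainTheorem1 (dT : measure_display) (T : measurableType dT) (R : realType)
  (P : probability T R) (d : nat) (Yv : seq 'I_d -> 'I_d -> T -> R) :
  (2 <= d)%N ->
  iid_family P Yv ->
  Dphi_int P Yv 0 ->
  forall beta : R, 0 <= beta -> (beta%:E < beta_c P Yv)%E ->
  forall p : R, 1 <= p ->
  exists C1 : R, 0 < C1 /\
    forall N M : nat, (1 <= N)%N -> (1 <= M)%N -> (M <= N)%N ->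
      (Lnorm P p%:E (EFin \o DKL P Yv beta M N) <= (C1 * (N %/ M)%:R)%:E)%E /\
      (Lnorm P p%:E (fun x => (DKL P Yv beta M N x - fine ('E_P[DKL P Yv beta M N]))%:E)
         <= C1%:E)%E.
Proof.
move=> d2 iidY D0 beta beta_ge0 beta_lt p p1.
pose Q := distribution P (env_mfun iidY).
have iidQ : iid_law Q := iid_law_distribution iidY.
have phiE := phi_distribution iidY.
have near0 : exists2 e, 0 < e & forall t, `|t| < e -> L1 Q (exp_sum t).
  have [e e0 De] := D0; exists e => // t te.
  by apply: (Dphi_L1 iidY); apply: De; rewrite subr0.
have subcritical : exists b, [/\ beta < b,
    exists2 e, 0 < e & forall t, `|t - b| < e -> L1 Q (exp_sum t) &
    b * derive1 (@ln R \o mgf_env Q) b < ln (mgf_env Q b)].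
  (* Lying strictly below a supremum yields a witness [b] of the slope condition beyond [beta], with
     a whole neighbourhood in the domain. *)
  have [_ [b [[e e0 De] slope] <-]] := ereal_sup_gt beta_lt.
  rewrite lte_fin => bb; exists b; split => //.
    by exists e => // t te; apply: (Dphi_L1 iidY); exact: De.
  by move: slope; rewrite phiE.
have fE : phi P Yv beta = ln (mgf_env Q beta) by rewrite phiE.
have edge1 := edge_mean1 d2 beta_ge0 subcritical.
have [r [ka [/andP[r0 r1] ka1 edge_r]]] := edge_moment d2 beta_ge0 subcritical.
have [s0 [B0 [s00 edge_e]]] := edge_exponential d2 beta_ge0 near0.
have mean1 := E_part_fun iidQ edge1.
have [Cr Cr0 HCr] := E_part_fun_pow iidQ d2 edge1 r0 r1 ka1 edge_r.
have edge_exp v i := edge_exp_at iidQ edge_e v i.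
have [rho rho01 Hrho] := E_gibbs_collision iidQ d2 mean1 r0 Cr0 HCr s00 edge_exp.
have [s [Cs [s_gt0 Cs_gt0 Hexp]]] := E_log_part_fun_exp iidQ d2 mean1 r0 Cr0 HCr s00 edge_exp.
have [C C0 HC] := kl_Lnorm iidQ (ltnW d2) s_gt0 Cs_gt0 Hexp rho01 Hrho p1.
exists C; split => // N M _ M_gt0 MN.
have [ikl H1 H2] := HC N M M_gt0 MN.
have DKL_kl : DKL P Yv beta M N = kl beta (ln (mgf_env Q beta)) N M \o env_mfun iidY.
  by rewrite -fE; apply/funext => x; exact: (DKLE P Yv beta (ltnW d2) N M_gt0 x).
rewrite DKL_kl expectation_distribution//.
have mkl := L1_meas ikl; split.
  by rewrite [leLHS](Lnorm_distribution iidY p mkl).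
pose F (y : @env R d) :=
  kl beta (ln (mgf_env Q beta)) N M y - EQ Q (kl beta (ln (mgf_env Q beta)) N M).
rewrite [leLHS](@Lnorm_distribution _ _ _ _ _ _ iidY p F)//.
by apply: depends_onB => //; exact: depends_on_cst.
Qed.
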